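(* The Calogero--Moser map $\omega:\mathcal C\to\mathcal R$ assigns to a point of $\mathcal C$ represented by $(\bar X,\bar Y,\bar i,\bar j)$ the isomorphism class of the fractional ideals $$M_x:=\det(\bar X-x)\,A+\kappa^{-1}\det(\bar Y-y)\,A,\qquad M_y:=\det(\bar Y-y)\,A+\kappa\,\det(\bar X-x)\,A,$$ where $\kappa:=1-\bar j\,(\bar Y-y)^{-1}(\bar X-x)^{-1}\,\bar i\in Q$.
   Context: Let $k$ be an algebraically closed field of characteristic zero, $A=A_1(k)=k\langle x,y\rangle/(xy-yx-1)$ the first Weyl algebra, $Q$ its quotient skew field. Modules are right modules. $\mathcal R$ is the set of isomorphism classes of finitely generated rank $1$ torsion-free $A$-modules (equivalently, nonzero right ideals of $A$). Here $\bar X-x$ means $\bar X\otimes1-\mathrm{Id}\otimes x\in\mathrm{End}(k^n)\otimes Q$ (the scalar matrices $\bar X,\bar Y$ commute with elements of $Q$), and similarly $\bar Y-y$; $\det(\bar X-x)\in k[x]$, $\det(\bar Y-y)\in k[y]$. $\mathcal C=\bigsqcup_{n\ge0}\mathcal C_n$, where $\mathcal C_n$ is the set of quadruples $(\bar X,\bar Y,\bar i,\bar j)$ with $\bar X,\bar Y\in\mathrm{End}(k^n)$, $\bar i\in\mathrm{Hom}(k,k^n)$, $\bar j\in\mathrm{Hom}(k^n,k)$, $[\bar X,\bar Y]+\mathrm{Id}_n=\bar i\,\bar j$, modulo $g\cdot(\bar X,\bar Y,\bar i,\bar j)=(g\bar Xg^{-1},g\bar Yg^{-1},g\bar i,\bar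 jg^{-1})$, $g\in GL_n(k)$. The map $\omega$ is the composite of Wilson's bijection $\mathcal C\to\mathrm{Gr}^{\mathrm{ad}}$ with the Cannings--Holland bijection $\mathrm{Gr}^{\mathrm{ad}}\to\mathcal R$. An element of the adelic Grassmannian $\mathrm{Gr}^{\mathrm{ad}}$ is a subspace $W=q^{-1}V\subset k(z)$ of the following kind. For finitely many $\lambda\in k$ one is given a finite-dimensional space $C_\lambda$ of functionals $c:f\mapsto\sum_rc_rf^{(r)}(\lambda)$; $V\subset k[z]$ is the common kernel of all these functionals, and $q=\prod_\lambda(z-\lambda)^{\dim C_\lambda}$. Its (stationary) Baker function is the unique $\psi_W(x,z)=e^{xz}\tilde\psi(x,z)$ (here $x,z$ are commuting variables) such that $q\tilde\psi$ is polynomial in $z$ with coefficients in $k(x)$, $\tilde\psi\to1$ as $z\to\infty$, and every $c\in C_\lambda$ (acting in $z$) annihilates $q\psi_W$. Wilson's map sends $[(\bar X,\bar Y,\bar i,\bar j)]$ to the unique $W$ with $\psi_W=e^{xz}\big(1-\bar j(\bar Y-z)^{-1}(\bar X-x)^{-1}\bar i\big)$. The Cannings--Holland map sends $W$ to the class of $\{D\in k(z)[\partial_z]:D(k[z])\subseteq W\}$, a right $A$-module via $y=z$, $x=\partial_z$. *)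

(* Defs.v *)
From HB Require Import structures.
From mathcomp Require Import all_boot all_order all_algebra.
From mathcomp Require Import generic_quotient fraction.
From mathcomp Require Import boolp classical_sets functions.

Set Implicit Arguments.
Unset Strict Implicit.
Unset Printing Implicit Defensive.

Import GRing.Theory.

Local Open Scope classical_set_scope.
Local Open Scope ring_scope.

(* (A, x, y) is the algebra k<x,y>/(xy - yx - 1), given by the universal
   property of this presentation. *)
Definition weyl_algebra (k : fieldType) (A : algType k) (x y : A) : Prop :=
  x * y - y * x = 1 /\
  forall (B : algType k) (u v : B), u * v - v * u = 1 ->
    exists f : {lrmorphism A -> B}, [/\ f x = u, f y = v &
      forall g : {lrmorphism A -> B}, g x = u -> g y = v -> g =1 f].

Definition quotient_skew_field (k : fieldType) (A : algType k)
    (Q : unitAlgType k) (iota : {lrmorphism A -> Q}) : Prop :=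
  [/\ injective iota,
      (forall u : Q, u != 0 -> u \is a GRing.unit) &
      forall u : Q, exists a b : A, b != 0 /\ u = iota a * (iota b)^-1].

(* The inverse of a square matrix over a not necessarily commutative ring
   (the library's [invmx] needs commutativity); 0 if there is none. *)
Definition ncinvmx (Q : nzRingType) (n : nat) (M : 'M[Q]_n) : 'M[Q]_n :=
  xget 0 [set N | M *m N = 1%:M /\ N *m M = 1%:M].

Record quad (k : fieldType) (n : nat) := Quad {
  qX : 'M[k]_n; qY : 'M[k]_n; qi : 'cV[k]_n; qj : 'rV[k]_n }.

Definition cm_eq (k : fieldType) (n : nat) (c : quad k n) : Prop :=
  qX c *m qY c - qY c *m qX c + 1%:M = qi c *m qj c.

Definition gl_act (k : fieldType) (n : nat) (g : 'M[k]_n) (c : quad k n) :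
    quad k n :=
  Quad (g *m qX c *m invmx g) (g *m qY c *m invmx g)
       (g *m qi c) (qj c *m invmx g).

Definition gl_orbit (k : fieldType) (n : nat) (c : quad k n) : set (quad k n) :=
  [set gl_act g c | g in [set g | g \in unitmx]].

(* The space C_n; its points are the GL_n(k)-orbits. *)
Definition calogero_moser (k : fieldType) (n : nat) : set (set (quad k n)) :=
  [set gl_orbit c | c in [set c : quad k n | cm_eq c]].

(* k(z); the same field also serves as k(x). *)
Notation ratfun k := {fraction {poly k}}.

Definition ratC (k : fieldType) (a : k) : ratfun k := tofrac a%:P.
Definition ratX (k : fieldType) : ratfun k := tofrac 'X.

(* d/dz on k(z); independent of the representative chosen by [repr]. *)
Definition ddz (k : fieldType) (f : ratfun k) : ratfun k :=
  let: n := \n_(repr f) in let: d := \d_(repr f) in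
  tofrac (n^`() * d - n * d^`()) / tofrac (d ^+ 2).

(* A vector c in [ad_fun lambda] encodes the functional
   f |-> \sum_r c_r f^(r)(lambda). The spaces attached to points outside
   [ad_pts] are ignored. *)
Record adelic_data (k : fieldType) := AdelicData {
  ad_ord : nat;
  ad_pts : seq k;
  ad_uniq : uniq ad_pts;
  ad_fun : k -> {vspace 'rV[k]_ad_ord} }.

Definition functional (k : fieldType) (m : nat) (c : 'rV[k]_m) (lambda : k)
    (f : {poly k}) : k :=
  \sum_(r < m) c 0 r * f^`(r).[lambda].

Definition ad_V (k : fieldType) (C : adelic_data k) : set {poly k} :=
  [set f | forall lambda, lambda \in ad_pts C ->
    forall c, c \in ad_fun C lambda -> functional c lambda f = 0].

Definition ad_q (k : fieldType) (C : adelic_data k) : {poly k} :=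
  \prod_(lambda <- ad_pts C) ('X - lambda%:P) ^+ \dim (ad_fun C lambda).

Definition ad_W (k : fieldType) (C : adelic_data k) : set (ratfun k) :=
  [set tofrac f / tofrac (ad_q C) | f in ad_V C].

(* k(x)(z), with outer variable z. *)
Notation ratfun2 k := (ratfun (ratfun k)).

(* A product e^{xz} g with g in k(x)[z] is represented by g, so that d/dz
   acts by g |-> g' + x g. As e^{x lambda} is a unit, the functional c kills
   e^{xz} g iff the value below, in which this factor is omitted, is 0. *)
Definition exp_derive (k : fieldType) (g : {poly (ratfun k)}) :
    {poly (ratfun k)} := g^`() + ratX k *: g.

Definition exp_functional (k : fieldType) (m : nat) (c : 'rV[k]_m) (lambda : k)
    (g : {poly (ratfun k)}) : ratfun k :=
  \sum_(r < m) ratC (c 0 r) * (iter r (@exp_derive k) g).[ratC lambda].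

(* f -> 1 at infinity: f - 1 is a fraction of negative degree. *)
Definition tends_to_one (K : fieldType) (f : ratfun K) : Prop :=
  (size \n_(repr (f - 1)%R) < size \d_(repr (f - 1)%R))%N.

(* e^{xz} psi is the Baker function of the subspace [ad_W C]. *)
Definition is_baker (k : fieldType) (C : adelic_data k) (psi : ratfun2 k) :
    Prop :=
  tends_to_one psi /\
  exists g : {poly (ratfun k)},
    tofrac (map_poly (@ratC k) (ad_q C)) * psi = tofrac g /\
    forall lambda, lambda \in ad_pts C ->
      forall c, c \in ad_fun C lambda -> exp_functional c lambda g = 0.

Definition psi_quad (k : fieldType) (n : nat) (c : quad k n) : ratfun2 k :=
  let: emb := fun a : k => tofrac (ratC a)%:P : ratfun2 k in
  let: x := tofrac (ratX k)%:P : ratfun2 k in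
  let: z := tofrac 'X : ratfun2 k in
  1 - (map_mx emb (qj c) *m invmx (map_mx emb (qY c) - z%:M)
        *m invmx (map_mx emb (qX c) - x%:M) *m map_mx emb (qi c)) 0 0.

(* The W in Gr^ad attached to a point P of C_n, i.e. the unique one whose
   Baker function is e^{xz} [psi_quad c], c being a representative of P. *)
Definition wilson (k : fieldType) (n : nat) (P : set (quad k n)) :
    set (ratfun k) :=
  xget set0 [set W | exists C : adelic_data k, W = ad_W C /\
                     exists2 c, P c & is_baker C (psi_quad c)].

(* k(z)[d/dz], as operators on k(z); char k = 0 makes this action faithful. *)
Definition diff_op (k : fieldType) (D : ratfun k -> ratfun k) : Prop :=
  exists a : {poly (ratfun k)},
    forall f, D f = \sum_(r < size a) a`_r * iter r (@ddz k) f.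

Definition cannings_holland (k : fieldType) (W : set (ratfun k)) :
    set (ratfun k -> ratfun k) :=
  [set D | diff_op D /\ forall f : {poly k}, W (D (tofrac f))].

(* The module representing the class omega(P) in R. *)
Definition omega (k : fieldType) (n : nat) (P : set (quad k n)) :
    set (ratfun k -> ratfun k) := cannings_holland (wilson P).

(* rho is the homomorphism from A to the operators on k(z) given by
   y |-> z, x |-> d/dz; A acts on operators on the right via D a = D o rho a. *)
Definition weyl_rep (k : fieldType) (A : algType k) (x y : A)
    (rho : A -> ratfun k -> ratfun k) : Prop :=
  [/\ forall (c : k) f, rho c%:A f = ratC c * f,
      forall a b f, rho (a + b) f = rho a f + rho b f,
      forall a b f, rho (a * b) f = rho a (rho b f),
      forall f, rho x f = ddz f &
      forall f, rho y f = ratX k * f].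

(* A right A-submodule M of Q and a right A-module N of operators on k(z)
   are isomorphic. *)
Definition right_iso (k : fieldType) (A : algType k) (Q : unitAlgType k)
    (iota : A -> Q) (rho : A -> ratfun k -> ratfun k)
    (M : set Q) (N : set (ratfun k -> ratfun k)) : Prop :=
  exists phi : Q -> ratfun k -> ratfun k,
    [/\ set_bij M N phi,
        forall m m' : Q, M m -> M m' ->
          forall f, phi (m + m') f = phi m f + phi m' f &
        forall (m : Q) (a : A), M m ->
          forall f, phi (m * iota a) f = phi m (rho a f)].

(* det(M - a) in k[a], for a in a k-algebra. *)
Definition det_sub (k : fieldType) (A : algType k) (n : nat) (M : 'M[k]_n)
    (a : A) : A :=
  horner_alg a (\det (map_mx polyC M - 'X%:M)).

Definition kappa (k : fieldType) (Q : unitAlgType k) (x y : Q) (n : nat)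
    (c : quad k n) : Q :=
  1 - (map_mx (in_alg Q) (qj c) *m ncinvmx (map_mx (in_alg Q) (qY c) - y%:M)
        *m ncinvmx (map_mx (in_alg Q) (qX c) - x%:M)
        *m map_mx (in_alg Q) (qi c)) 0 0.

Definition right_span2 (k : fieldType) (A : algType k) (Q : unitAlgType k)
    (iota : A -> Q) (u v : Q) : set Q :=
  [set m | exists a b : A, m = u * iota a + v * iota b].

Definition M_x (k : fieldType) (A : algType k) (x y : A) (Q : unitAlgType k)
    (iota : A -> Q) (n : nat) (c : quad k n) : set Q :=
  right_span2 iota (iota (det_sub (qX c) x))
    ((kappa (iota x) (iota y) c)^-1 * iota (det_sub (qY c) y)).

Definition M_y (k : fieldType) (A : algType k) (x y : A) (Q : unitAlgType k)
    (iota : A -> Q) (n : nat) (c : quad k n) : set Q :=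
  right_span2 iota (iota (det_sub (qY c) y))
    (kappa (iota x) (iota y) c * iota (det_sub (qX c) x)).

(* Main.v *)
(* Write f = det(Y - y), d = det(X - x), and let C be adelic data with Baker
   function e^{xz} psi, q = ad_q C, V = ad_V C, W = q^{-1} V. Elements of
   k(y)[x] act on k(z); those mapping k[z] to W form a right A-module N.

   N = M_y. The Baker condition says that kappa d lies in N. As
   (X - x)(Y - y) - (Y - y)(X - x) = i j, one has
   kappa^{-1} = 1 + j (X - x)^{-1} (Y - y)^{-1} i, so f s(x) lies in kappa d A
   for some s <> 0; as the symbol of f s(x) is s(x) times the symbol of f, it
   follows that f lies in N. Conversely, for u in N the uniqueness of the Baker
   function, applied to the symbol of u, gives s <> 0 with u s(x) in kappa d A, and clearing denominators gives p <> 0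
   with u p(y) in f A. If u (x - l) and u p(y) lie in M_y then so does u p'(y),
   hence so does u, by induction on the degree of p; splitting s into linear
   factors gives u in M_y. Finally M_x = kappa^{-1} M_y.

   W exists. At each root l of f of multiplicity m one needs an m-dimensional
   space of functionals annihilating f psi. Such functionals are the residues at
   l against p + v (Y - z)^{-1} i, where the component of v X - j p(Y) in the
   generalized eigenspace of Y for l vanishes; count parameters. *)

(* Operators are written in normal form, with y to the left of x. Then scaling a symbol by c(x) is
   right multiplication by c(x), and functionals act in z only, so being killed by them is a
   k(x)-linear condition on symbols. This is what allows a factor s(x) to be divided out of a
   symbol; factors p(y) on the left are removed instead through their roots, which lie in k, where
   symbols can be evaluated.

   Uniqueness of the Baker function is a count over k(x). The deg q independent functionals leave no
   nonzero solution of degree below deg q in z, and the operators q kappa d y^m have degrees deg q +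
   m, so their symbols span all solutions.

   For existence, the dual function times the Baker operator applied to h turns out to be a total
   derivative plus a part regular at l. A dual function inducing the zero functional must vanish;
   the last step of this is again a descent by differentiation, as in the induction on p.

   Since [wilson] is a choice, the module is computed for arbitrary adelic data with the given Baker
   function, and existence ensures that the chosen W has such data. *)
From HB Require Import structures.
Require Import Defs.
From mathcomp Require Import all_boot all_order all_algebra.
From mathcomp Require Import generic_quotient fraction.
From mathcomp Require Import boolp classical_sets functions.
From mathcomp Require Import ring.

Set Implicit Arguments.
Unset Strict Implicit.
Unset Printing Implicit Defensive.

Import GRing.Theory.

Local Open Scope ring_scope.

(** * Subalgebras of the Weyl algebra *)

Section WeylInduction.
Variables (k : fieldType) (A : algType k) (x y : A).
Hypothesis hA : weyl_algebra x y.
Variable T : A -> Prop.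
Hypotheses (T1 : T 1) (TB : forall a b, T a -> T b -> T (a - b))
  (TZ : forall (t : k) a, T a -> T (t *: a))
  (TM : forall a b, T a -> T b -> T (a * b)) (Tx : T x) (Ty : T y).

(** Boolean form of [T], so that its elements form an algebra to which the universal property can be
    applied. *)
Definition weyl_sub : {pred A} := fun a => `[< T a >].

Fact weyl_sub_closed : subalg_closed weyl_sub.
Proof.
split=> [|t a b /asboolP Ta /asboolP Tb|a b /asboolP Ta /asboolP Tb].
- exact/asboolP.
- apply/asboolP; rewrite -[b]opprK; apply: TB; first exact: TZ.
  by rewrite -scaleN1r; apply: TZ.
- exact/asboolP/TM.
Qed.

HB.instance Definition _ :=
  GRing.isSubalgClosed.Build k A weyl_sub
    (GRing.subalg_closed_semi weyl_sub_closed).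

Record weyl_sub_type := WeylSub {
  weyl_sub_val :> A; weyl_sub_valP : weyl_sub_val \in weyl_sub }.
HB.instance Definition _ := [isSub for weyl_sub_val].
HB.instance Definition _ := [Choice of weyl_sub_type by <:].
HB.instance Definition _ := [SubChoice_isSubAlgebra of weyl_sub_type by <:].

Definition weyl_sub_incl (f : {lrmorphism A -> weyl_sub_type}) (a : A) : A :=
  weyl_sub_val (f a).

Fact weyl_sub_incl_scalable f : scalable (weyl_sub_incl f).
Proof. by move=> t a; rewrite /weyl_sub_incl linearZ. Qed.

HB.instance Definition _ f := GRing.RMorphism.copy (weyl_sub_incl f)
  ((\val : weyl_sub_type -> A) \o (f : {rmorphism A -> weyl_sub_type})).
HB.instance Definition _ f := GRing.isScalable.Build k A A *:%R
  (weyl_sub_incl f) (weyl_sub_incl_scalable f).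

(* The inclusion of the subalgebra [T] followed by the map [A -> T] given by
   the universal property is the identity, as it fixes [x] and [y]. *)
Lemma weyl_ind a : T a.
Proof.
have [hxy huniv] := hA.
have hx : x \in weyl_sub by exact/asboolP.
have hy : y \in weyl_sub by exact/asboolP.
pose u := WeylSub hx; pose v := WeylSub hy.
have uv : u * v - v * u = 1 :> weyl_sub_type.
  by apply: val_inj; rewrite rmorphB !rmorphM; exact: hxy.
have [f [fx fy _]] := huniv weyl_sub_type u v uv.
have [g [gx gy guniq]] := huniv A x y hxy.
pose F : {lrmorphism A -> A} := weyl_sub_incl f.
have Fid : F a = a.
  have -> : F a = g a by apply: guniq; rewrite /F /= /weyl_sub_incl ?fx ?fy.
  by rewrite -(guniq (idfun : {lrmorphism A -> A})).
have : F a \in weyl_sub by exact: weyl_sub_valP.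
by rewrite Fid => /asboolP.
Qed.
End WeylInduction.

(** * Differential operators with polynomial coefficients *)

Section Operators.
Variable k : fieldType.
Implicit Types (c h u : {poly k}) (P : {poly {poly k}}).

Definition dop c h : {poly k} := \sum_(l < size c) c`_l *: h^`(l).

Lemma dop_widen n c h : (size c <= n)%N ->
  dop c h = \sum_(l < n) c`_l *: h^`(l).
Proof.
move=> cn; rewrite /dop (big_ord_widen n (fun l => c`_l *: h^`(l)) cn).
rewrite big_mkcond /=; apply: eq_bigr => l _.
by case: ltnP => // cl; rewrite nth_default ?scale0r.
Qed.

Lemma dop0 h : dop 0 h = 0.
Proof. by rewrite /dop size_poly0 big_ord0. Qed.

Lemma dopD c1 c2 h : dop (c1 + c2) h = dop c1 h + dop c2 h.
Proof.
pose n := maxn (size c1) (size c2).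
rewrite !(@dop_widen n) ?leq_maxl ?leq_maxr ?size_polyD // -big_split /=.
by apply: eq_bigr => l _; rewrite coefD scalerDl.
Qed.

Lemma dopZ t c h : dop (t *: c) h = t *: dop c h.
Proof.
rewrite !(@dop_widen (size c)) ?size_scale_leq // scaler_sumr.
by apply: eq_bigr => l _; rewrite coefZ scalerA.
Qed.

Lemma dopC t h : dop t%:P h = t *: h.
Proof.
rewrite (@dop_widen 1) ?size_polyC ?leq_b1 // big_ord1 coefC eqxx.
by rewrite derivn0.
Qed.

Lemma dopXM c h : dop ('X * c) h = dop c h^`().
Proof.
rewrite (@dop_widen (size c).+1); last first.
  by rewrite (leq_trans (size_polyMleq _ _)) // size_polyX addSn.
rewrite big_ord_recl /= coefXM eqxx scale0r add0r.
by apply: eq_bigr => l _; rewrite /bump /= coefXM -derivSn.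
Qed.

Lemma dopX h : dop 'X h = h^`().
Proof. by rewrite -['X]mulr1 dopXM -polyC1 dopC scale1r. Qed.

Lemma dop_is_linear c : linear (dop c).
Proof.
move=> t h1 h2; rewrite /dop scaler_sumr -big_split /=; apply: eq_bigr => l _.
by rewrite derivnD derivnZ scalerDr !scalerA mulrC.
Qed.
HB.instance Definition _ c :=
  GRing.isLinear.Build k {poly k} {poly k} *:%R (dop c) (dop_is_linear c).

Lemma dop_sum (I : Type) (r : seq I) (F : I -> {poly k}) h :
  dop (\sum_(i <- r) F i) h = \sum_(i <- r) dop (F i) h.
Proof.
by elim/big_rec2: _ => [|i y1 y2 _ <-]; rewrite ?dop0 ?dopD.
Qed.

Lemma dop_deriv c h : (dop c h)^`() = dop c h^`().
Proof.
rewrite /dop linear_sum /=; apply: eq_bigr => l _.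
by rewrite derivZ -derivSn -derivnS.
Qed.

Lemma dopM c1 c2 h : dop (c1 * c2) h = dop c1 (dop c2 h).
Proof.
elim/poly_ind: c1 => [|c t IH] in h *; first by rewrite mul0r !dop0.
rewrite mulrDl !dopD mul_polyC dopZ dopC.
by rewrite -mulrA [c * 'X]mulrC mulrCA !dopXM IH dop_deriv.
Qed.

(* The outer variable of P is z; the inner one stands for d/dz. *)
Definition op P h : {poly k} := \sum_(i < size P) 'X^i * dop P`_i h.

Lemma op_widen n P h : (size P <= n)%N ->
  op P h = \sum_(i < n) 'X^i * dop P`_i h.
Proof.
move=> cn; rewrite /op (big_ord_widen n (fun i => 'X^i * dop P`_i h) cn).
rewrite big_mkcond /=; apply: eq_bigr => l _.
by case: ltnP => // cl; rewrite nth_default // dop0 mulr0.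
Qed.

Lemma op0 h : op 0 h = 0.
Proof. by rewrite /op size_poly0 big_ord0. Qed.

Lemma opD P1 P2 h : op (P1 + P2) h = op P1 h + op P2 h.
Proof.
pose n := maxn (size P1) (size P2).
rewrite !(@op_widen n) ?leq_maxl ?leq_maxr ?size_polyD // -big_split /=.
by apply: eq_bigr => l _; rewrite coefD dopD mulrDr.
Qed.

Lemma opC c h : op c%:P h = dop c h.
Proof.
rewrite (@op_widen 1) ?size_polyC ?leq_b1 // big_ord1 coefC eqxx.
by rewrite expr0 mul1r.
Qed.

Lemma opXM P h : op ('X * P) h = 'X * op P h.
Proof.
rewrite (@op_widen (size P).+1); last first.
  by rewrite (leq_trans (size_polyMleq _ _)) // size_polyX addSn.
rewrite big_ord_recl /= coefXM eqxx dop0 mulr0 add0r mulr_sumr.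
by apply: eq_bigr => l _; rewrite /bump /= coefXM add1n /= exprS mulrA.
Qed.

Lemma op_cons P c h : op (P * 'X + c%:P) h = 'X * op P h + dop c h.
Proof. by rewrite opD mulrC opXM opC. Qed.

(** In the normal form z stands to the left of d/dz, so a factor c of the coefficients acts first:
    it is composition with c(d/dz) on the right. *)
Lemma opZ c P h : op (c *: P) h = op P (dop c h).
Proof.
elim/poly_ind: P => [|P b IH]; first by rewrite scaler0 !op0.
rewrite scalerDr scalerAl -[c *: b%:P]mul_polyC -polyCM !op_cons.
by rewrite IH [c * b]mulrC dopM.
Qed.

Lemma op_is_linear P : linear (op P).
Proof.
move=> t h1 h2; rewrite /op scaler_sumr -big_split /=; apply: eq_bigr => l _.
by rewrite linearP mulrDr scalerAr.
Qed.
HB.instance Definition _ P :=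
  GRing.isLinear.Build k {poly k} {poly k} *:%R (op P) (op_is_linear P).

Lemma op_mull u P h : op (map_poly polyC u * P) h = u * op P h.
Proof.
elim/poly_ind: u => [|u t IH]; first by rewrite rmorph0 !mul0r op0.
rewrite rmorphD rmorphM /= map_polyX map_polyC /= [_ * 'X]mulrC [u * 'X]mulrC.
rewrite !mulrDl opD -!mulrA opXM IH; congr (_ + _).
by rewrite !mul_polyC opZ dopC linearZ.
Qed.

Lemma op_sum (I : Type) (r : seq I) (F : I -> {poly {poly k}}) h :
  op (\sum_(i <- r) F i) h = \sum_(i <- r) op (F i) h.
Proof. by elim/big_rec2: _ => [|i y1 y2 _ <-]; rewrite ?op0 ?opD. Qed.

(* Composition with d/dz on the left. *)
Definition dz P : {poly {poly k}} := P^`() + 'X *: P.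

Lemma op_deriv P h : (op P h)^`() = op (dz P) h.
Proof.
rewrite /dz opD opZ dopX.
elim/poly_ind: P => [|P b IH]; first by rewrite deriv0 !op0 deriv0 addr0.
rewrite derivD derivC addr0 derivM derivX mulr1 !op_cons opD derivD derivM.
rewrite IH derivX mul1r dop_deriv [P^`() * 'X]mulrC opXM.
by ring.
Qed.

(* Composition with z on the right. *)
Definition zr P : {poly {poly k}} := 'X * P + map_poly (@deriv k) P.

Lemma map_deriv_cons P c : map_poly (@deriv k) (P * 'X + c%:P) =
  map_poly (@deriv k) P * 'X + c^`()%:P.
Proof.
have coefm Q i : (map_poly (@deriv k) Q)`_i = (Q`_i)^`().
  by rewrite coef_map_id0 ?deriv0.
apply/polyP => i; rewrite coefm !coefD !coefMX !coefC derivD coefm.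
by case: i => [|i] //=; rewrite !deriv0.
Qed.

Lemma dop_mulX c h : dop c ('X * h) = 'X * dop c h + dop c^`() h.
Proof.
elim/poly_ind: c => [|c t IH] in h *.
  by rewrite deriv0 !dop0 mulr0 addr0.
rewrite derivD derivC addr0 derivM derivX mulr1 [c * 'X]mulrC !dopD !dopXM
  !dopC.
rewrite derivM derivX mul1r linearD /= IH [c^`() * 'X]mulrC dopXM scalerAr.
by ring.
Qed.

Lemma op_mulX P h : op P ('X * h) = op (zr P) h.
Proof.
rewrite /zr opD opXM; elim/poly_ind: P => [|P b IH].
  by rewrite map_poly0 !op0 mulr0 addr0.
by rewrite map_deriv_cons !op_cons IH dop_mulX; ring.
Qed.

(** The correction term has no larger degree in z than P. Iterating [zr] thus yields one operator in
    each degree from that of P on. *)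
Lemma size_zr P : P != 0 -> size (zr P) = (size P).+1.
Proof.
move=> P0; have sX : size ('X * P) = (size P).+1.
  by rewrite mulrC size_mulX.
have lt : (size (map_poly (@deriv k) P) < size ('X * P)%R)%N.
  by rewrite sX ltnS size_poly.
by rewrite /zr size_polyDl.
Qed.

Lemma horner_op P h l : (op P h).[l] = (dop P.[l%:P] h).[l].
Proof.
elim/poly_ind: P => [|P b IH]; first by rewrite horner0 op0 dop0 horner0.
rewrite op_cons !hornerE IH dopD [_ * l%:P]mulrC mul_polyC dopZ.
by rewrite !hornerE.
Qed.

Lemma derivn_XsubC_exp l s m :
  (('X - l%:P : {poly k}) ^+ s)^`(m) = ('X - l%:P) ^+ (s - m) *+ s ^_ m.
Proof.
elim: m => [|m IH]; first by rewrite derivn0 ffactn0 subn0 mulr1n.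
rewrite derivnS IH derivMn deriv_exp derivXsubC mul1r -mulrnA mulnC ffactnSr.
by rewrite -subnS.
Qed.

Lemma horner_derivn_XsubC l s m :
  (('X - l%:P : {poly k}) ^+ s)^`(m).[l] = (s`!)%:R *+ (m == s).
Proof.
rewrite derivn_XsubC_exp hornerMn horner_exp !hornerE subrr expr0n subn_eq0.
case: (ltngtP m s) => [ms|sm|->]; rewrite ?mulr0n ?mul0rn //.
  by rewrite ffact_small // mulr0n.
by rewrite ffactnn.
Qed.

(** At l all derivatives of (z - l)^s vanish except the s-th, so this test function isolates one
    coefficient of c. *)
Lemma horner_dop_XsubC c l s :
  (dop c (('X - l%:P) ^+ s)).[l] = c`_s * (s`!)%:R.
Proof.
rewrite (@dop_widen (maxn (size c) s.+1)) ?leq_maxl // horner_sum.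
have sn : (s < maxn (size c) s.+1)%N by rewrite leq_max ltnS leqnn orbT.
rewrite (bigD1 (Ordinal sn)) //= big1 => [|i]; last first.
  rewrite -val_eqE /= => ns.
  by rewrite hornerZ horner_derivn_XsubC (negPf ns) mulr0.
by rewrite addr0 hornerZ horner_derivn_XsubC eqxx.
Qed.

End Operators.

Lemma tofrac_inj (R : idomainType) : injective (@tofrac R).
Proof. by move=> p q /eqP; rewrite tofrac_eq => /eqP. Qed.

Lemma frac_repr (R : idomainType) (f : {fraction R}) :
  tofrac \d_(repr f) * f = tofrac \n_(repr f).
Proof.
rewrite -{2}[f]reprK; set x := repr f.
rewrite !piE; apply/eqmodP; rewrite /= FracField.equivfE /FracField.mulf.
by rewrite !numden_Ratio ?mulr1 ?mul1r ?oner_eq0 ?denom_ratioP.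
Qed.

HB.instance Definition _ (k : fieldType) := GRing.RMorphism.copy (@ratC k)
  ((@tofrac {poly k}) \o polyC).

Lemma deriv_neq0 (k : fieldType) (p : {poly k}) : [pchar k] =i pred0 ->
  (1 < size p)%N -> p^`() != 0.
Proof.
move=> hk sp; apply/eqP => /(congr1 (fun r : {poly k} => r`_(size p).-2)) /eqP.
have e : (size p).-2.+1 = (size p).-1 by rewrite prednK // -subn1 subn_gt0.
rewrite coef_deriv coef0 e -lead_coefE -mulr_natr mulf_eq0 lead_coef_eq0.
by rewrite ((pcharf0P k).1 hk) -size_poly_eq0;
  case: (size p) sp => [|[]].
Qed.

(** In characteristic zero a nonconstant polynomial has a nonzero derivative, so repeated
    differentiation ends at a nonzero constant. *)
Lemma poly_descent (k : fieldType) (T : {poly k} -> Prop) p :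
  [pchar k] =i pred0 -> p != 0 -> T p -> (forall r, T r -> T r^`()) ->
  exists2 t, t != 0 & T t%:P.
Proof.
move=> hk p0 Tp TD; have [s] := ubnP (size p); elim: s => // s IH in p p0 Tp *.
move=> sp; have [s1|s1] := leqP (size p) 1.
  have ep := size1_polyC s1; exists p`_0; last by rewrite -ep.
  by rewrite -polyC_eq0 -ep.
apply: (IH p^`()); [exact: deriv_neq0 | exact: TD |].
by apply: leq_trans (lt_size_deriv p0) _.
Qed.

(** * Symbols: operators applied to e^{xz} *)

Section Symbols.
Variable k : closedFieldType.
Hypothesis hk : [pchar k] =i pred0.
Implicit Types (c h u : {poly k}) (P : {poly {poly k}}) (l : k).

(* [op P] maps e^{xz} to e^{xz} [symbol P]. *)
Definition symbol P : {poly (ratfun k)} := map_poly (@tofrac {poly k}) P.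

Lemma symbol_ratC u : symbol (map_poly polyC u) = map_poly (@ratC k) u.
Proof. by rewrite /symbol -map_poly_comp. Qed.

Lemma symbol_inj : injective symbol.
Proof. by apply: map_inj_poly; [exact: tofrac_inj | exact: rmorph0]. Qed.

Lemma size_sym P : size (symbol P) = size P.
Proof. by apply: size_map_inj_poly; [exact: tofrac_inj | exact: rmorph0]. Qed.

Lemma natr_inj (i j : nat) : i%:R = j%:R :> k -> i = j.
Proof.
wlog ij : i j / (i <= j)%N => [hw e|].
  by case: (leqP i j) => [|/ltnW] ij; [|apply/esym]; exact: hw.
rewrite -{1}(subnKC ij) natrD => /eqP; rewrite -subr_eq0 opprD addNKr oppr_eq0.
rewrite ((pcharf0P k).1 hk) subn_eq0 => ji; apply/eqP; rewrite eqn_leq ij.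
exact: ji.
Qed.

Lemma fact_neq0 n : (n`!)%:R != 0 :> k.
Proof. by rewrite ((pcharf0P k).1 hk) -lt0n fact_gt0. Qed.

Lemma dop_eq0 c l : (forall h, (dop c h).[l] = 0) -> c = 0.
Proof.
move=> c0; apply/polyP => s; rewrite coef0.
have /eqP := c0 (('X - l%:P) ^+ s).
by rewrite horner_dop_XsubC mulf_eq0 (negPf (fact_neq0 _)) orbF => /eqP.
Qed.

Lemma horner_op_eq0 P l : (forall h, (op P h).[l] = 0) -> P.[l%:P] = 0.
Proof. by move=> P0; apply: (@dop_eq0 _ l) => h; rewrite -horner_op. Qed.

(** Every l is a root of P over k[x], and in characteristic zero the integers already give more
    distinct roots than the degree allows. *)
Lemma op_eq0 P : (forall h, op P h = 0) -> P = 0.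
Proof.
move=> P0; apply: (@roots_geq_poly_eq0 _ P [seq (i%:R)%:P | i <- iota 0 (size
  P)]).
- by apply/allP => _ /mapP[i _ ->]; apply/eqP/horner_op_eq0 => h;
  rewrite P0 horner0.
- rewrite map_inj_uniq ?iota_uniq // => i j /polyC_inj.
  exact: natr_inj.
- by rewrite size_map size_iota.
Qed.

(** The roots of p are removed one at a time: at a root l every [op P h] vanishes, hence so does
    P(l, x), by testing on powers of z - l. *)
Lemma op_dvd (p : {poly k}) P : p != 0 -> (forall h, p %| op P h) ->
  exists P1, P = map_poly polyC p * P1.
Proof.
have [r ->] := closed_field_poly_normal p.
set t := lead_coef p; rewrite scaler_eq0 => /norP[t0 _].
move=> dv; have {dv} : forall h, \prod_(z <- r) ('X - z%:P) %| op P h.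
  by move=> h; have := dv h; rewrite dvdpZl.
elim: r P => [|z r IH] P dv.
  exists ((t^-1)%:P *: P); rewrite big_nil map_polyZ /= map_polyC /=.
  by rewrite -scalerAl mul1r scalerA -polyCM divff // scale1r.
have Pz : P.[z%:P] = 0.
  apply: horner_op_eq0 => h; apply/rootP; rewrite -dvdp_XsubCl.
  by apply: dvdp_trans (dv h); rewrite big_cons dvdp_mulIl.
have /factor_theorem[P1 defP] : root P z%:P by exact/rootP.
have [P2 defP1] : exists P2, P1 = map_poly polyC (t *: \prod_(z <- r) ('X -
  z%:P)) * P2.
  apply: IH => h; have := dv h; rewrite big_cons defP [P1 * _]mulrC.
  have -> : 'X - z%:P%:P = map_poly polyC ('X - z%:P) :> {poly {poly k}}.
    by rewrite rmorphB /= map_polyX map_polyC.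
  by rewrite op_mull dvdp_mul2l // polyXsubC_eq0.
exists P2; rewrite defP defP1 big_cons scalerAr rmorphM /= [X in _ = X *
  _]mulrC.
by rewrite -!mulrA [P2 * _]mulrC; congr (_ * (_ * _));
  rewrite rmorphB /= map_polyX map_polyC.
Qed.

(** The roots of p are constants, so evaluation at them commutes with the passage from k[x] to k(x),
    and linear factors can be split off over k[x]. *)
Lemma symbol_dvd (p : {poly k}) P g : p != 0 ->
  symbol P = map_poly (@ratC k) p * g -> exists P1, P = map_poly polyC p * P1.
Proof.
have [r ->] := closed_field_poly_normal p.
set t := lead_coef p; rewrite scaler_eq0 => /norP[t0 _].
rewrite map_polyZ /= -scalerAl scalerAr; move: (ratC t *: g) => {}g.
elim: r P => [|z r IH] P dv.
  exists ((t^-1)%:P *: P); rewrite big_nil map_polyZ /= map_polyC /=.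
  by rewrite -scalerAl mul1r scalerA -polyCM divff // scale1r.
have Pz : P.[z%:P] = 0.
  apply/eqP; rewrite -tofrac_eq0 -(horner_map (@tofrac {poly k})) -/(symbol P)
    dv.
  rewrite big_cons rmorphM rmorphB /= map_polyX map_polyC /= !hornerE.
  by rewrite subrr !mul0r.
have /factor_theorem[P1 defP] : root P z%:P by exact/rootP.
have eXz : 'X - z%:P%:P = map_poly polyC ('X - z%:P) :> {poly {poly k}}.
  by rewrite rmorphB /= map_polyX map_polyC.
have [P2 defP1] : exists P2, P1 = map_poly polyC (t *: \prod_(z <- r) ('X -
  z%:P)) * P2.
  apply: IH; apply: (@mulfI _ (map_poly (@ratC k) ('X - z%:P))).
    by rewrite map_poly_eq0 polyXsubC_eq0.
  rewrite mulrA -rmorphM; move: dv; rewrite big_cons => <-.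
  rewrite defP eXz [P1 * _]mulrC.
  by rewrite /symbol rmorphM; congr (_ * _); exact/esym/symbol_ratC.
exists P2; rewrite defP defP1 big_cons scalerAr rmorphM /= [X in _ = X *
  _]mulrC.
by rewrite -!mulrA [P2 * _]mulrC; congr (_ * (_ * _)).
Qed.

(** What c leaves of e^{xz} P at l once e^{xl} is dropped. Read as an operator, the same polynomial
    in x computes c on [op P h]. *)
Definition symval m (c : 'rV[k]_m) l P : {poly k} :=
  \sum_(r < m) c 0 r *: (iter r (@dz k) P).[l%:P].

Lemma functional_op m (c : 'rV[k]_m) l P h :
  functional c l (op P h) = (dop (symval c l P) h).[l].
Proof.
rewrite /functional /symval dop_sum horner_sum; apply: eq_bigr => r _.
rewrite dopZ hornerZ -horner_op; congr (_ * _.[l]).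
elim: (nat_of_ord r) => [|i IH]; first by rewrite derivn0.
by rewrite derivnS IH op_deriv.
Qed.

Lemma exp_derive_sym P : exp_derive (symbol P) = symbol (dz P).
Proof.
by rewrite /exp_derive /dz /symbol rmorphD /= deriv_map linearZ.
Qed.

Lemma exp_functional_sym m (c : 'rV[k]_m) l P :
  exp_functional c l (symbol P) = tofrac (symval c l P).
Proof.
rewrite /exp_functional /symval rmorph_sum; apply: eq_bigr => r _.
rewrite -mul_polyC rmorphM /= -horner_map; congr (_ * _.[_]).
by elim: (nat_of_ord r) => //= i ->; rewrite exp_derive_sym.
Qed.

(** Both sides say that [symval c l P] is zero, once as a scalar in k(x) and once as an operator
    followed by evaluation at l. *)
Lemma functional_opP m (c : 'rV[k]_m) l P :
  exp_functional c l (symbol P) = 0 <-> forall h, functional c l (op P h) = 0.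
Proof.
rewrite exp_functional_sym; split=> [/eqP|P0].
  by rewrite tofrac_eq0 => /eqP e h; rewrite functional_op e dop0 horner0.
by rewrite (@dop_eq0 (symval c l P) l) ?rmorph0 // => h; rewrite -functional_op.
Qed.

Variable C : adelic_data k.

Definition exp_V (g : {poly (ratfun k)}) :=
  forall l, l \in ad_pts C -> forall v, v \in ad_fun C l ->
    exp_functional v l g = 0.

Lemma exp_V_sym P : exp_V (symbol P) <-> forall h, ad_V C (op P h).
Proof.
split=> PV => [h l lC c cC|l lC c cC].
  by apply: (functional_opP c l P).1; exact: PV.
by apply/functional_opP => h; exact: PV.
Qed.

End Symbols.

(** * Uniqueness of the Baker function *)

Section TwistedDerivative.
Variables (K : fieldType) (x : K).
Implicit Types (g h u : {poly K}) (a : K).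

(** The conjugate of d/dz by e^{xz}. The field and x are left general: x = 0 gives the ordinary
    derivative, so the same lemmas serve for [functional]. *)
Definition twd g : {poly K} := g^`() + x *: g.

Fact twd_is_linear : linear twd.
Proof.
move=> t g h; rewrite /twd derivD derivZ !scalerDr !scalerA [t * _]mulrC.
by rewrite addrACA.
Qed.
HB.instance Definition _ := GRing.isLinear.Build K {poly K} {poly K} *:%R
  twd twd_is_linear.

Lemma iter_twdP r t g h :
  iter r twd (t *: g + h) = t *: iter r twd g + iter r twd h.
Proof. by elim: r => //= r ->; rewrite linearP. Qed.

(** The twist only contributes terms of higher order at a, so the leading coefficient there changes
    as under d/dz. *)
Lemma iter_twd_XsubC a s u r : (r <= s)%N ->
  exists2 v, iter r twd (('X - a%:P) ^+ s * u) = ('X - a%:P) ^+ (s - r) * v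
           & v.[a] = u.[a] *+ s ^_ r.
Proof.
elim: r => [_|r IH rs]; first by exists u; rewrite ?subn0 ?ffactn0 ?mulr1n.
have [v ev va] := IH (ltnW rs); rewrite iterS ev.
have -> : (s - r = (s - r.+1).+1)%N by rewrite subnS prednK // subn_gt0.
set e := (s - r.+1)%N.
exists (v *+ e.+1 + ('X - a%:P) * twd v).
  rewrite /twd derivM deriv_exp derivXsubC mul1r -mul_polyC /= exprS.
  by rewrite -mul_polyC; ring.
rewrite hornerD hornerM hornerXsubC subrr mul0r addr0 hornerMn va -mulrnA
  ffactnSr.
by rewrite /e subnS prednK // subn_gt0.
Qed.

Definition twval m (c : 'rV[K]_m) a g : K :=
  \sum_(r < m) c 0 r * (iter r twd g).[a].

Lemma twvalP m (c : 'rV[K]_m) a t g h :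
  twval c a (t *: g + h) = t * twval c a g + twval c a h.
Proof.
rewrite /twval mulr_sumr -big_split /=; apply: eq_bigr => r _.
by rewrite iter_twdP hornerD hornerZ mulrDr mulrCA.
Qed.

Lemma twval_dvd m (c : 'rV[K]_m) a g :
  ('X - a%:P) ^+ m %| g -> twval c a g = 0.
Proof.
move=> /dvdpP[u ->]; rewrite mulrC; apply: big1 => r _.
have [v -> _] := iter_twd_XsubC a u (ltnW (ltn_ord r)).
rewrite hornerM horner_exp hornerXsubC subrr expr0n subn_eq0 leqNgt ltn_ord.
by rewrite mul0r mulr0.
Qed.

(** Triangularity: on (z - a)^s u the orders below s contribute nothing and the coefficients above s
    are already known to be zero, so the coefficients vanish from the top order down. *)
Lemma twval_eq0 m (c : 'rV[K]_m) a u : [pchar K] =i pred0 -> u.[a] != 0 ->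
  (forall h, twval c a (u * h) = 0) -> c = 0.
Proof.
move=> hK u0 c0; apply/rowP => s; rewrite mxE.
have [n] := ubnP (m - s); elim: n => // n IH in s * => ms.
have := c0 (('X - a%:P) ^+ s); rewrite mulrC /twval.
rewrite (bigD1 s) //= big1 => [|r rs]; last first.
  case: (ltngtP r s) => [lt|gt|/val_inj e]; last by rewrite e eqxx in rs.
    have [v -> _] := iter_twd_XsubC a u (ltnW lt).
    rewrite hornerM horner_exp hornerXsubC subrr expr0n subn_eq0 leqNgt lt.
    by rewrite mul0r mulr0.
  rewrite IH ?mul0r //; rewrite ltnS in ms; apply: leq_trans ms.
  exact: ltn_sub2l.
have [v -> va] := iter_twd_XsubC a u (leqnn s).
rewrite addr0 subnn expr0 mul1r va ffactnn => /eqP.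
rewrite mulf_eq0 -mulr_natr mulf_eq0 (negPf u0) ((pcharf0P K).1 hK).
by rewrite -[_ == 0%N]negbK -lt0n fact_gt0 orbF => /eqP.
Qed.
End TwistedDerivative.

Section BakerUniqueness.
Variable k : closedFieldType.
Hypothesis hk : [pchar k] =i pred0.
Notation K := (ratfun k).
Implicit Types (g h u : {poly K}) (l : k).

Lemma exp_functionalE m (c : 'rV[k]_m) l g :
  exp_functional c l g = twval (ratX k) (map_mx (@ratC k) c) (ratC l) g.
Proof. by apply: eq_bigr => r _; rewrite mxE. Qed.

Lemma exp_functionalP m (c : 'rV[k]_m) l t g h :
  exp_functional c l (t *: g + h) =
  t * exp_functional c l g + exp_functional c l h.
Proof. by rewrite !exp_functionalE twvalP. Qed.

Lemma exp_functional0 m (c : 'rV[k]_m) l : exp_functional c l 0 = 0.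
Proof.
have := exp_functionalP c l (-1) 0 0; rewrite scaler0 addr0 mulN1r => ->.
by rewrite addNr.
Qed.

Lemma pchar_ratfun : [pchar K] =i pred0.
Proof.
apply/(pcharf0P K) => n.
by rewrite -(rmorph_nat (@ratC k)) fmorph_eq0 ((pcharf0P k).1 hk).
Qed.

Variable C : adelic_data k.
Notation pts := (ad_pts C).

Definition fidx := {i : 'I_(size pts) & 'I_(\dim (ad_fun C (pts`_i)))}.
HB.instance Definition _ := Finite.on fidx.

Definition fpt (t : fidx) : k := pts`_(tag t).
Definition fvec (t : fidx) : 'rV[k]_(ad_ord C) :=
  (vbasis (ad_fun C (pts`_(tag t))))`_(tagged t).
Definition fval (t : fidx) g : K := exp_functional (fvec t) (fpt t) g.

Lemma fval_exp_V g : exp_V C g -> forall t, fval t g = 0.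
Proof.
move=> gV t; apply: gV; first by rewrite mem_nth.
by apply: vbasis_mem; rewrite mem_nth // size_tuple.
Qed.

Lemma fvalP t a g h : fval t (a *: g + h) = a * fval t g + fval t h.
Proof. exact: exp_functionalP. Qed.

Lemma exp_VP a g h : exp_V C g -> exp_V C h -> exp_V C (a *: g + h).
Proof.
by move=> gV hV l lC v vC; rewrite exp_functionalP gV // hV // mulr0 addr0.
Qed.

Lemma exp_V0 : exp_V C 0.
Proof. by move=> l lC v vC; exact: exp_functional0. Qed.

Lemma exp_VZ a g : exp_V C g -> exp_V C (a *: g).
Proof. by move=> gV; rewrite -[_ *: _]addr0; apply: exp_VP => //;
  exact: exp_V0. Qed.

(* Test against the multiples of \prod_(l' != l) (z - l')^m to isolate the point
   l. *)
Lemma fval_free (al : fidx -> K) :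
  (forall g, \sum_t al t * fval t g = 0) -> forall t, al t = 0.
Proof.
move=> al0 [i j].
pose m := ad_ord C.
pose D i := \dim (ad_fun C (pts`_i)).
pose b (i : 'I_(size pts)) (j : 'I_(D i)) : 'rV[k]_m := fvec (existT _ i j).
pose ga (i : 'I_(size pts)) : 'rV[K]_m :=
  \sum_(j < D i) al (existT _ i j) *: map_mx (@ratC k) (b i j).
have al1 g : \sum_i twval (ratX k) (ga i) (ratC pts`_i) g = 0.
  rewrite -[RHS](al0 g).
  transitivity (\sum_(i < size pts) \sum_(j < D i)
      al (existT _ i j) * fval (existT _ i j) g); last first.
    rewrite (@sig_big_dep _ _ _ 'I_(size pts) (fun i => 'I_(D i)) xpredT
      (fun _ => xpredT) (fun i j => al (existT _ i j) * fval (existT _ i j) g)).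
    by apply: eq_bigr => -[].
  apply: eq_bigr => i' _; rewrite /twval /ga.
  under eq_bigr do rewrite summxE mulr_suml.
  rewrite exchange_big /=; apply: eq_bigr => j' _.
  rewrite /fval exp_functionalE /twval mulr_sumr; apply: eq_bigr => r _.
  by rewrite !mxE mulrA.
have ga0 : ga i = 0.
  pose u := \prod_(i' < size pts | i' != i) ('X - (ratC pts`_i')%:P) ^+ m.
  apply: (@twval_eq0 _ (ratX k) _ _ (ratC pts`_i) u pchar_ratfun).
    rewrite horner_prod; apply/prodf_neq0 => i' ne.
    rewrite horner_exp !hornerE expf_neq0 // -rmorphB fmorph_eq0 subr_eq0.
    by rewrite nth_uniq ?(ad_uniq C) // eq_sym.
  move=> h; rewrite -[RHS](al1 (u * h)) (bigD1 i) //= big1 ?addr0 // => i' ne.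
  apply: twval_dvd; rewrite /u (bigD1 i') //= -mulrA.
  exact: dvdp_mulIl.
pose B : 'M[k]_(D i, m) := \matrix_j b i j.
(* Independence over k persists over k(x), as the rank does not change under field extension. *)
have fB : row_free (map_mx (@ratC k) B).
  rewrite row_free_map -kermx_eq0; apply/eqP/row_matrixP => r.
  rewrite row0; set w := row r _.
  have wB : w *m B = 0 by rewrite -row_mul mulmx_ker row0.
  have /freeP fr := basis_free (vbasisP (ad_fun C (pts`_i))).
  apply/rowP => j'; rewrite [RHS]mxE; apply: (fr (fun j => w 0 j)).
  rewrite -[RHS]wB mulmx_sum_row; apply: eq_bigr => j1 _.
  by rewrite rowK.
pose a : 'rV[K]_(D i) := \row_j al (existT _ i j).
have : a *m map_mx (@ratC k) B = 0.
  rewrite -[RHS]ga0 mulmx_sum_row; apply: eq_bigr => j1 _.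
  by rewrite mxE -map_row rowK.
move=> aB; have /rowP/(_ j) : a = 0.
  by apply: (row_free_inj fB); rewrite /= aB mul0mx.
by rewrite !mxE.
Qed.

Lemma card_fidx : #|{: fidx}|.+1 = size (ad_q C).
Proof.
rewrite /ad_q size_prod_seq => [|l _]; last first.
  by rewrite expf_neq0 // polyXsubC_eq0.
have -> : (\sum_(l <- pts) size (('X - l%:P) ^+ \dim (ad_fun C l)) =
           \sum_(l <- pts) \dim (ad_fun C l) + size pts)%N.
  rewrite -sum1_size -big_split /=; apply: eq_bigr => l _.
  by rewrite size_exp_XsubC addn1.
rewrite addnC -addnS addKn; congr _.+1.
rewrite (big_nth 0) big_mkord /= card_tagged sumnE big_map big_enum /=.
by apply: eq_bigr => i _; rewrite card_ord.
Qed.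

Variable w : nat -> {poly K}.
Hypotheses (wV : forall m, exp_V C (w m))
  (size_w : forall m, size (w m) = (size (ad_q C) + m)%N).

Lemma reduce_w g : (size (ad_q C) <= size g)%N ->
  exists m (a : K), (size (g - a *: w m)%R < size g)%N.
Proof.
move=> sg; have q0 : (0 < size (ad_q C))%N by rewrite -card_fidx.
have g0 : g != 0 by rewrite -size_poly_gt0 (leq_trans q0).
pose m := (size g - size (ad_q C))%N.
have swm : size (w m) = size g by rewrite size_w subnKC.
have w0 : w m != 0 by rewrite -size_poly_gt0 swm size_poly_gt0.
pose a := lead_coef g / lead_coef (w m).
have a0 : a != 0 by rewrite mulf_neq0 ?invr_eq0 ?lead_coef_eq0.
exists m, a; rewrite -scaleNr; apply: (leq_ltn_trans (n := (size g).-1)).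
  apply/leq_sizeP => j; rewrite leq_eqVlt => /predU1P[<-|jg]; last first.
    have jg' : (size g <= j)%N by rewrite -(prednK (leq_trans q0 sg)).
    by rewrite coefD coefZ !nth_default ?swm // mulr0 addr0.
  rewrite coefD coefZ -{2}swm -!lead_coefE mulNr /a mulfVK ?lead_coef_eq0 //.
  by rewrite subrr.
by rewrite prednK // size_poly_gt0.
Qed.

(* The values of the r functionals on 1, z, .., z^(r-1) form a square matrix; it
   is invertible because the functionals are independent and, modulo the w m,
   every polynomial has size at most r. *)
Lemma exp_V_small g : exp_V C g -> (size g < size (ad_q C))%N -> g = 0.
Proof.
move=> gV sg; pose N := #|{: fidx}|.
pose E : 'M[K]_N := \matrix_(d, t) fval (enum_val t) 'X^d.
have fv0 t : fval t 0 = 0 by apply/exp_functional0.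
have fvE t h : (size h <= N)%N -> fval t h = \sum_(d < N) h`_d * fval t 'X^d.
  move=> sh; rewrite -{1}[h]coefK (poly_def (size h)).
  have -> : \sum_(i < size h) h`_i *: 'X^i = \sum_(i < N) h`_i *: 'X^i.
    rewrite (big_ord_widen N (fun i => h`_i *: 'X^i) sh) big_mkcond /=.
    by apply: eq_bigr => i _; case: ltnP => // hi; rewrite nth_default ?scale0r.
  elim/big_rec2: _ => [|i y1 y2 _ <-]; first exact: fv0.
  exact: fvalP.
case: (eqVneq (poly_rV g : 'rV_N) 0) => [g0|g0].
  by rewrite -(@poly_rV_K _ N g) ?g0 ?linear0 // -ltnS card_fidx.
have : \det E = 0.
  apply/eqP/det0P; exists (poly_rV g) => //; apply/rowP => t; rewrite !mxE.
  rewrite -[RHS](fval_exp_V gV (enum_val t)) fvE;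
    last by rewrite -ltnS card_fidx.
  by apply: eq_bigr => d _; rewrite !mxE.
rewrite -det_tr => /eqP/det0P[v v0 vE].
pose al t := v 0 (enum_rank t).
suff al0 h : \sum_t al t * fval t h = 0.
  case/negP: v0; apply/eqP/rowP => t; rewrite mxE -[t]enum_valK.
  exact: (fval_free al0).
have sum_small h' : (size h' <= N)%N -> \sum_t al t * fval t h' = 0.
  move=> sh; under eq_bigr do rewrite fvE // mulr_sumr.
  rewrite exchange_big big1 //= => d _.
  have /rowP/(_ d) := vE; rewrite !mxE => vd.
  under eq_bigr do rewrite mulrCA; rewrite -mulr_sumr.
  rewrite (reindex (@enum_val fidx (mem {: fidx}))); last first.
    by apply/onW_bij/enum_val_bij.
  rewrite (eq_bigr (fun t => v 0 t * E^T t d)) ?vd ?mulr0 // => t _.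
  by rewrite /al enum_valK !mxE.
have [s] := ubnP (size h); elim: s => // s IH in h * => sh.
case: (leqP (size h) N) => [/sum_small //|]; rewrite card_fidx => /reduce_w.
case=> m [a lt]; rewrite -(subrK (a *: w m) h) addrC.
under eq_bigr do rewrite fvalP (fval_exp_V (wV m)) mulr0 add0r.
by apply: IH; apply: leq_trans lt _.
Qed.

(** Division by the w m, which have the degrees deg q, deg q + 1, ..., leaves a remainder that is
    still killed and has degree below deg q; it is zero by [exp_V_small]. *)
Lemma exp_V_span g : exp_V C g ->
  exists s (a : nat -> K), g = \sum_(m < s) a m *: w m.
Proof.
move=> gV; suff [t ->] : exists t : seq (nat * K), g = \sum_(p <- t) p.2 *: w
  p.1.
  pose s := (\max_(p <- t) p.1).+1.
  exists s, (fun m => \sum_(p <- t | p.1 == m) p.2).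
  rewrite (eq_big_seq (fun p : nat * K =>
    \sum_(m < s | p.1 == m :> nat) p.2 *: w m)); last first.
    move=> p pt; have ps : (p.1 < s)%N by rewrite ltnS (leq_bigmax_seq p).
    by rewrite (big_pred1 (Ordinal ps)).
  rewrite (exchange_big_dep xpredT) //=; apply: eq_bigr => m _.
  by rewrite scaler_suml.
have [s] := ubnP (size g); elim: s => // s IH in g gV * => sg.
case: (ltnP (size g) (size (ad_q C))) => [lt|/reduce_w[m [a lt]]].
  by exists [::]; rewrite big_nil (exp_V_small gV lt).
have [] := IH (g - a *: w m); last 1 first.
- by move=> t et; exists ((m, a) :: t); rewrite big_cons /= -et addrC subrK.
- by rewrite -scaleNr addrC; apply: exp_VP.
- exact: leq_trans lt _.
Qed.
End BakerUniqueness.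
(** * The normal form in the Weyl algebra and its action on k(z) *)

Lemma ddz_tofrac (k : fieldType) (h : {poly k}) : ddz (tofrac h) = tofrac h^`().
Proof.
rewrite /ddz; set n := \n_(repr (tofrac h)); set d := \d_(repr (tofrac h)).
have d0 : d != 0 by rewrite denom_ratioP.
have -> : n = d * h.
  by apply: tofrac_inj; rewrite tofracM -frac_repr.
have -> : (d * h)^`() * d - d * h * d^`() = h^`() * d ^+ 2.
  by rewrite derivM; ring.
by rewrite tofracM mulfK // tofrac_eq0 expf_neq0.
Qed.

Section WeylAlgebra.
Variable k : closedFieldType.
Hypothesis hk : [pchar k] =i pred0.
Variables (A : algType k) (x y : A).
Hypothesis hA : weyl_algebra x y.
Variable rho : A -> ratfun k -> ratfun k.
Hypothesis hrho : weyl_rep x y rho.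
Implicit Types (a b : A) (c u h : {poly k}) (P : {poly {poly k}}).
Local Notation hx := (horner_alg x).
Local Notation hy := (horner_alg y).

Lemma weyl_comm : x * y = y * x + 1.
Proof. by have [<- _] := hA; rewrite addrC subrK. Qed.

Lemma horner_alg_cons (z : A) c t :
  horner_alg z (c * 'X + t%:P) = horner_alg z c * z + t%:A.
Proof. by rewrite rmorphD rmorphM /= horner_algX horner_algC. Qed.

Lemma horner_alg_comm (z : A) c : horner_alg z c * z = z * horner_alg z c.
Proof. by rewrite -{2 3}(horner_algX z) -!rmorphM mulrC. Qed.

Lemma x_hy c : x * hy c = hy c * x + hy c^`().
Proof.
elim/poly_ind: c => [|c t IH];
  first by rewrite deriv0 !rmorph0 mulr0 mul0r addr0.
rewrite derivD derivC addr0 derivM derivX mulr1 !horner_alg_cons.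
rewrite [hy (_ + _)]rmorphD rmorphM /= horner_algX.
rewrite mulrDr mulrA IH !mulrDl -!mulrA weyl_comm mulrDr mulr1.
rewrite mulr_algr mulr_algl -!addrA; congr (_ + _).
by rewrite addrCA [RHS]addrCA; congr (_ + _); exact: addrC.
Qed.

Lemma hx_y c : hx c * y = y * hx c + hx c^`().
Proof.
elim/poly_ind: c => [|c t IH];
  first by rewrite deriv0 !rmorph0 mulr0 mul0r addr0.
rewrite derivD derivC addr0 derivM derivX mulr1 !horner_alg_cons.
rewrite [hx (_ + _)]rmorphD rmorphM /= horner_algX.
rewrite mulrDl -mulrA weyl_comm mulrDr mulr1 mulrA IH mulrDl mulrDr.
rewrite mulr_algr mulr_algl !mulrA -!addrA; congr (_ + _).
by rewrite addrC -addrA addrC addrA.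
Qed.

(** The order, y before x, is that of [op]: under [rho], [ev P] acts on k[z] as [op P]. *)
Definition ev P : A := \sum_(i < size P) y ^+ i * hx P`_i.

Lemma ev_widen n P : (size P <= n)%N -> ev P = \sum_(i < n) y ^+ i * hx P`_i.
Proof.
move=> cn; rewrite /ev (big_ord_widen n (fun i => y ^+ i * hx P`_i) cn).
rewrite big_mkcond /=; apply: eq_bigr => l _.
by case: ltnP => // cl; rewrite nth_default // rmorph0 mulr0.
Qed.

Lemma ev0 : ev 0 = 0. Proof. by rewrite /ev size_poly0 big_ord0. Qed.

Lemma evD P1 P2 : ev (P1 + P2) = ev P1 + ev P2.
Proof.
pose n := maxn (size P1) (size P2).
rewrite !(@ev_widen n) ?leq_maxl ?leq_maxr ?size_polyD // -big_split /=.
by apply: eq_bigr => l _; rewrite coefD rmorphD mulrDr.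
Qed.

Lemma evC c : ev c%:P = hx c.
Proof.
rewrite (@ev_widen 1) ?size_polyC ?leq_b1 // big_ord1 coefC eqxx.
by rewrite expr0 mul1r.
Qed.

Lemma evXM P : ev ('X * P) = y * ev P.
Proof.
rewrite (@ev_widen (size P).+1); last first.
  by rewrite (leq_trans (size_polyMleq _ _)) // size_polyX addSn.
rewrite big_ord_recl /= coefXM eqxx rmorph0 mulr0 add0r mulr_sumr.
by apply: eq_bigr => l _; rewrite /bump /= coefXM add1n /= exprS mulrA.
Qed.

Lemma ev_cons P c : ev (P * 'X + c%:P) = y * ev P + hx c.
Proof. by rewrite evD mulrC evXM evC. Qed.

Lemma evZ c P : ev (c *: P) = ev P * hx c.
Proof.
elim/poly_ind: P => [|P b IH]; first by rewrite scaler0 !ev0 mul0r.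
rewrite scalerDr scalerAl -[c *: b%:P]mul_polyC -polyCM !ev_cons.
by rewrite IH mulrDl mulrA -rmorphM [c * b]mulrC.
Qed.

Lemma ev_mull u P : ev (map_poly polyC u * P) = hy u * ev P.
Proof.
elim/poly_ind: u => [|u t IH]; first by rewrite !rmorph0 !mul0r ev0.
rewrite rmorphD rmorphM /= map_polyX map_polyC /= [_ * 'X]mulrC.
rewrite !mulrDl evD -!mulrA evXM IH horner_alg_cons mulrDl; congr (_ + _).
  by rewrite mulrA -horner_alg_comm.
by rewrite mul_polyC evZ horner_algC mulr_algr mulr_algl.
Qed.

Lemma ev_hy u : ev (map_poly polyC u) = hy u.
Proof. by rewrite -[map_poly _ _]mulr1 ev_mull -polyC1 evC rmorph1 mulr1. Qed.

Lemma x_ev P : x * ev P = ev (dz P).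
Proof.
rewrite /dz evD evZ horner_algX; elim/poly_ind: P => [|P c IH].
  by rewrite deriv0 !ev0 mulr0 mul0r addr0.
rewrite derivD derivC addr0 derivM derivX mulr1 !ev_cons evD [_ * 'X]mulrC evXM.
rewrite mulrDr mulrA weyl_comm mulrDl mul1r -mulrA IH mulrDr mulrDl.
rewrite -horner_alg_comm -!mulrA !addrA; congr (_ + _).
by rewrite -!addrA; congr (_ + _); rewrite addrC.
Qed.

Lemma ev_zr P : ev (zr P) = ev P * y.
Proof.
rewrite /zr evD evXM; elim/poly_ind: P => [|P c IH].
  by rewrite map_poly0 !ev0 mulr0 mul0r addr0.
rewrite map_deriv_cons !ev_cons mulrDr mulrDl -mulrA -IH mulrDr hx_y !addrA.
congr (_ + _); rewrite -!addrA; congr (_ + _); exact: addrC.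
Qed.

(** The elements whose left multiplication preserves normal forms are a subalgebra containing x and
    y; each is then applied to 1. *)
Lemma ev_surj a : exists P, a = ev P.
Proof.
suff aT : forall P, exists P', a * ev P = ev P'.
  by have [P eP] := aT 1; exists P; rewrite -eP -polyC1 evC rmorph1 mulr1.
move: a; apply: (weyl_ind hA (T := fun a => forall P, exists P', a * ev P = ev
  P')).
- by move=> P; exists P; rewrite mul1r.
- move=> a b aT bT P; have [P1 e1] := aT P; have [P2 e2] := bT P.
  exists (P1 + (-1)%:P *: P2); rewrite mulrBl e1 e2 evD evZ horner_algC.
  by rewrite mulr_algr scaleN1r.
- move=> t a aT P; have [P1 e1] := aT P; exists (t%:P *: P1).
  by rewrite evZ horner_algC mulr_algr -scalerAl e1.
- move=> a b aT bT P; have [P1 e1] := bT P; have [P2 e2] := aT P1.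
  by exists P2; rewrite -mulrA e1.
- by move=> P; exists (dz P); exact: x_ev.
- by move=> P; exists ('X * P); rewrite evXM.
Qed.

Lemma rho_alg t f : rho t%:A f = ratC t * f. Proof. by case: hrho. Qed.
Lemma rhoD a b f : rho (a + b) f = rho a f + rho b f. Proof. by case: hrho. Qed.
Lemma rhoM a b f : rho (a * b) f = rho a (rho b f). Proof. by case: hrho. Qed.
Lemma rho_x f : rho x f = ddz f. Proof. by case: hrho. Qed.
Lemma rho_y f : rho y f = ratX k * f. Proof. by case: hrho. Qed.

Lemma rho0 f : rho 0 f = 0.
Proof. by rewrite -[0 : A](scale0r 1) rho_alg rmorph0 mul0r. Qed.

Lemma rho_sum (I : Type) (r : seq I) (F : I -> A) f :
  rho (\sum_(i <- r) F i) f = \sum_(i <- r) rho (F i) f.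
Proof. by elim/big_rec2: _ => [|i y1 y2 _ <-]; rewrite ?rho0 ?rhoD. Qed.

Lemma rho_hy u f : rho (hy u) f = tofrac u * f.
Proof.
elim/poly_ind: u => [|u t IH]; first by rewrite !rmorph0 rho0 mul0r.
rewrite horner_alg_cons rhoD horner_alg_comm rhoM rho_y IH rho_alg rmorphD.
by rewrite rmorphM mulrDl [_ * tofrac 'X]mulrC mulrA.
Qed.

Lemma rho_hx c h : rho (hx c) (tofrac h) = tofrac (dop c h).
Proof.
elim/poly_ind: c => [|c t IH] in h *;
  first by rewrite rmorph0 rho0 dop0 rmorph0.
rewrite horner_alg_cons rhoD rhoM rho_x ddz_tofrac IH rho_alg dopD dopC.
by rewrite [c * 'X]mulrC dopXM rmorphD -mul_polyC rmorphM.
Qed.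

Lemma rho_ev P h : rho (ev P) (tofrac h) = tofrac (op P h).
Proof.
elim/poly_ind: P => [|P c IH]; first by rewrite ev0 rho0 op0 rmorph0.
by rewrite ev_cons rhoD rhoM IH rho_y rho_hx op_cons rmorphD rmorphM.
Qed.

(** Normal forms are unique because the action on k[z] is faithful. *)
Lemma ev_eq0 P : ev P = 0 -> P = 0.
Proof.
move=> P0; apply: (op_eq0 hk) => h; apply: tofrac_inj.
by rewrite -rho_ev P0 rho0 rmorph0.
Qed.

Lemma ev_inj : injective ev.
Proof.
move=> P1 P2 e; apply/eqP; rewrite -subr_eq0; apply/eqP/ev_eq0.
have -> : P1 - P2 = P1 + (-1)%:P *: P2 by rewrite polyCN polyC1 scaleN1r.
by rewrite evD evZ e horner_algC mulr_algr scaleN1r subrr.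
Qed.

Lemma hy_eq0 u : hy u = 0 -> u = 0.
Proof.
rewrite -ev_hy => /ev_eq0 e; apply/eqP; rewrite -(map_poly_eq0 (@polyC k)).
exact/eqP.
Qed.

Lemma hx_eq0 c : hx c = 0 -> c = 0.
Proof. by rewrite -evC => /ev_eq0/polyC_inj. Qed.

(* Taking the square of e makes [e, a] a right multiple of e for a = x, y. *)
Lemma ore (z : A) :
  (forall e, exists b, x * horner_alg z (e * e) = horner_alg z e * b) ->
  (forall e, exists b, y * horner_alg z (e * e) = horner_alg z e * b) ->
  forall a e, e != 0 ->
    exists2 p, p != 0 & exists b, a * horner_alg z p = horner_alg z e * b.
Proof.
move=> hx2 hy2.
apply: (weyl_ind hA (T := fun a => forall e, e != 0 ->
  exists2 p, p != 0 & exists b, a * horner_alg z p = horner_alg z e * b)).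
- by move=> e e0; exists e => //; exists 1; rewrite mul1r mulr1.
- move=> a b aT bT e e0; have [p1 p10 [b1 e1]] := aT e e0.
  have [p2 p20 [b2 e2]] := bT e e0; exists (p1 * p2);
    first by rewrite mulf_neq0.
  exists (b1 * horner_alg z p2 - b2 * horner_alg z p1).
  by rewrite mulrBl mulrBr !mulrA -e1 -e2 -!mulrA -!rmorphM [p2 * p1]mulrC.
- move=> t a aT e e0; have [p p0 [b eb]] := aT e e0; exists p => //.
  by exists (t *: b); rewrite -scalerAl eb scalerAr.
- move=> a b aT bT e e0; have [p1 p10 [b1 e1]] := aT e e0.
  have [p2 p20 [b2 e2]] := bT p1 p10; exists p2 => //; exists (b1 * b2).
  by rewrite -mulrA e2 !mulrA e1.
- move=> e e0; exists (e * e); first by rewrite mulf_neq0.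
  exact: hx2.
- move=> e e0; exists (e * e); first by rewrite mulf_neq0.
  exact: hy2.
Qed.

Lemma ore_y a e : e != 0 -> exists2 p, p != 0 & exists b, a * hy p = hy e * b.
Proof.
move=> e0; apply: ore => // {a e e0} e.
  exists (hy e * x + hy e^`() + hy e^`()).
  rewrite x_hy derivM !rmorphD !rmorphM /= !mulrDr -!rmorphM /=.
  by rewrite [e^`() * e]mulrC !mulrA -rmorphM addrA.
by exists (hy e * y); rewrite -horner_alg_comm rmorphM mulrA.
Qed.

Lemma ore_x a e : e != 0 -> exists2 p, p != 0 & exists b, a * hx p = hx e * b.
Proof.
move=> e0; apply: ore => // {a e e0} e.
  by exists (hx e * x); rewrite -horner_alg_comm rmorphM mulrA.
exists (hx e * y - (hx e^`() + hx e^`())).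
have -> : y * hx (e * e) = hx (e * e) * y - hx (e * e)^`().
  by rewrite hx_y addrK.
rewrite derivM [e^`() * e]mulrC rmorphD !rmorphM /= mulrBr mulrDr.
by rewrite !mulrA.
Qed.
End WeylAlgebra.
(** * The element kappa *)

Section Ncinvmx.
Variables (Q : unitRingType) (n : nat).

Lemma ncinvmxP (M N : 'M[Q]_n) : M *m N = 1%:M -> N *m M = 1%:M ->
  ncinvmx M = N.
Proof.
move=> MN NM; have [_ e] : M *m ncinvmx M = 1%:M /\ ncinvmx M *m M = 1%:M.
  exact: (@xgetPex _ _ [set N | M *m N = 1%:M /\ N *m M = 1%:M]%classic
    (ex_intro _ N (conj MN NM))).
by rewrite -[ncinvmx M]mulmx1 -MN mulmxA e mul1mx.
Qed.

Variables (R : comNzRingType) (phi : {rmorphism R -> Q}) (B : 'M[R]_n).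
Hypothesis detU : phi (\det B) \is a GRing.unit.

Let adjV : 'M[Q]_n := (phi (\det B))^-1 *: map_mx phi (\adj B).

Let mulmx_adjV : map_mx phi B *m adjV = 1%:M.
Proof.
have com u : phi u * (phi (\det B))^-1 = (phi (\det B))^-1 * phi u.
  by apply/commrV; rewrite /GRing.comm -!rmorphM mulrC.
have -> : map_mx phi B *m adjV = (phi (\det B))^-1 *: map_mx phi (B *m \adj B).
  rewrite map_mxM; apply/matrixP => i j; rewrite !mxE big_distrr /=.
  by apply: eq_bigr => l _; rewrite !mxE mulrA com -mulrA.
rewrite mul_mx_adj; apply/matrixP => i j.
by rewrite !mxE rmorphMn mulrnAr mulVr.
Qed.

Let adjV_mulmx : adjV *m map_mx phi B = 1%:M.
Proof.
rewrite -scalemxAl -map_mxM mul_adj_mx; apply/matrixP => i j.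
by rewrite !mxE rmorphMn mulrnAr mulVr.
Qed.

(** The entries lie in the image of a commutative ring, so Cramer's rule holds and the inverse of
    the determinant commutes with them. *)
Lemma ncinvmx_adj : ncinvmx (map_mx phi B) =
  (phi (\det B))^-1 *: map_mx phi (\adj B).
Proof. exact: ncinvmxP. Qed.

Lemma mulmx_ncinv : map_mx phi B *m ncinvmx (map_mx phi B) = 1%:M.
Proof. by rewrite ncinvmx_adj. Qed.

Lemma ncinv_mulmx : ncinvmx (map_mx phi B) *m map_mx phi B = 1%:M.
Proof. by rewrite ncinvmx_adj. Qed.
End Ncinvmx.

(** Multiplying a b - b a = I J by b^{-1} a^{-1} on the left and a^{-1} b^{-1} on the right gives
    a^{-1} b^{-1} - b^{-1} a^{-1}; hence the quadratic term of the product cancels the linear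
    ones. *)
Lemma commutator_inverse (Q : nzRingType) m n (a ai b bi : 'M[Q]_n)
    (I : 'M[Q]_(n, m)) (J : 'M[Q]_(m, n)) :
  a *m ai = 1%:M -> ai *m a = 1%:M -> b *m bi = 1%:M -> bi *m b = 1%:M ->
  a *m b - b *m a = I *m J ->
  (1%:M - J *m bi *m ai *m I) *m (1%:M + J *m ai *m bi *m I) = 1%:M.
Proof.
move=> aV Va bV Vb comm_ab.
set k1 := J *m bi *m ai *m I; set k2 := J *m ai *m bi *m I.
have k12 : k1 *m k2 = k2 - k1.
  transitivity (J *m (bi *m ai *m (I *m J) *m (ai *m bi)) *m I).
    by rewrite !mulmxA.
  have -> : bi *m ai *m (I *m J) *m (ai *m bi) = ai *m bi - bi *m ai.
    rewrite -comm_ab mulmxBr mulmxBl; congr (_ - _).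
      rewrite !mulmxA -[bi *m ai *m a]mulmxA Va mulmx1 -[bi *m b]/(bi *m b) Vb.
      by rewrite mul1mx.
    rewrite -!mulmxA [a *m (ai *m _)]mulmxA aV mul1mx bV mulmx1.
    by [].
  by rewrite mulmxBr mulmxBl !mulmxA.
rewrite mulmxDr mulmx1 mulmxBl mul1mx k12 opprB [k2 + _]addrC.
by rewrite !subrK.
Qed.

Lemma mx11_mulB (Q : nzRingType) (u v : 'M[Q]_1) :
  (1%:M - u) *m (1%:M + v) = 1%:M -> (1 - u 0 0) * (1 + v 0 0) = 1.
Proof. by move=> /matrixP/(_ 0 0); rewrite !mxE big_ord1 !mxE. Qed.

Section Kappa.
Variable k : closedFieldType.
Variables (Q : unitAlgType k) (n : nat) (c : quad k n) (x y : Q).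
Hypothesis Qunit : forall u : Q, u != 0 -> u \is a GRing.unit.
Hypotheses (hxy : x * y - y * x = 1) (hc : cm_eq c).
Hypothesis (x_inj : forall p, horner_alg x p = 0 -> p = 0).
Hypothesis (y_inj : forall p, horner_alg y p = 0 -> p = 0).

Definition charX (M : 'M[k]_n) := map_mx polyC M - 'X%:M.

Lemma map_charX (z : Q) (M : 'M[k]_n) :
  map_mx (horner_alg z) (charX M) = map_mx (in_alg Q) M - z%:M.
Proof.
by apply/matrixP => i j;
  rewrite !mxE rmorphB rmorphMn /= horner_algC horner_algX.
Qed.

Lemma det_charX_neq0 M : \det (charX M) != 0.
Proof.
have -> : charX M = - char_poly_mx M by rewrite /charX /char_poly_mx opprB.
rewrite -scaleN1r detZ mulf_neq0 ?signr_eq0 //.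
by rewrite -[\det _]/(char_poly M) monic_neq0 // char_poly_monic.
Qed.

Lemma in_alg_comm (t : k) (u : Q) : in_alg Q t * u = u * in_alg Q t.
Proof. by rewrite mulr_algl mulr_algr. Qed.

Lemma map_in_alg_scalar (M : 'M[k]_n) (z : Q) :
  map_mx (in_alg Q) M *m z%:M = z%:M *m map_mx (in_alg Q) M.
Proof.
rewrite mul_scalar_mx; apply/matrixP => i j; rewrite !mxE (bigD1 j) //= big1.
  by rewrite !mxE eqxx mulr1n addr0 in_alg_comm.
by move=> l lj; rewrite !mxE (negPf lj) mulr0n mulr0.
Qed.

Local Notation a := (map_mx (in_alg Q) (qX c) - x%:M).
Local Notation b := (map_mx (in_alg Q) (qY c) - y%:M).
Local Notation I := (map_mx (in_alg Q) (qi c)).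
Local Notation J := (map_mx (in_alg Q) (qj c)).
Local Notation hx := (horner_alg x).
Local Notation hy := (horner_alg y).

(** Matrices over k commute with x and y, so the cross terms cancel, and [x, y] = 1 supplies the
    identity matrix of the Calogero--Moser equation. *)
Lemma comm_ab : a *m b - b *m a = I *m J.
Proof.
rewrite -map_mxM -hc map_mxD map_mxB map_mx1 !map_mxM.
set XX := map_mx _ (qX c); set YY := map_mx _ (qY c).
have -> : 1%:M = x%:M *m y%:M - y%:M *m x%:M :> 'M[Q]_n.
  by rewrite -!scalar_mxM -hxy rmorphB.
rewrite !mulmxBl !mulmxBr !map_in_alg_scalar !opprB.
set s1 := XX *m YY; set s2 := YY *m XX; set t1 := x%:M *m YY.
set t2 := y%:M *m XX; set r1 := x%:M *m _; set r2 := y%:M *m _.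
move: s1 s2 t1 t2 r1 r2 => s1 s2 t1 t2 r1 r2.
rewrite addrACA ![_ - _ + (_ - _)]subrKA [r1 - s2]addrC addrACA.
by rewrite [- r2 + _]addrC.
Qed.

Let aE : a = map_mx hx (charX (qX c)). Proof. by rewrite map_charX. Qed.
Let bE : b = map_mx hy (charX (qY c)). Proof. by rewrite map_charX. Qed.

Lemma horner_det_unitX : hx (\det (charX (qX c))) \is a GRing.unit.
Proof.
apply: Qunit; apply/eqP => /x_inj e; move: (det_charX_neq0 (qX c)).
by rewrite e eqxx.
Qed.

Lemma horner_det_unitY : hy (\det (charX (qY c))) \is a GRing.unit.
Proof.
apply: Qunit; apply/eqP => /y_inj e; move: (det_charX_neq0 (qY c)).
by rewrite e eqxx.
Qed.

Definition kappa' : Q := 1 + (J *m ncinvmx a *m ncinvmx b *m I) 0 0.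

Lemma mul_kappa_kappa' : kappa x y c * kappa' = 1.
Proof.
have [aV Va bV Vb] : [/\ a *m ncinvmx a = 1%:M, ncinvmx a *m a = 1%:M,
    b *m ncinvmx b = 1%:M & ncinvmx b *m b = 1%:M].
  rewrite aE bE; split; rewrite ?mulmx_ncinv ?ncinv_mulmx //.
  - exact: horner_det_unitX.
  - exact: horner_det_unitX.
  - exact: horner_det_unitY.
  - exact: horner_det_unitY.
exact: mx11_mulB (commutator_inverse aV Va bV Vb comm_ab).
Qed.

Lemma kappa_unit : kappa x y c \is a GRing.unit /\ (kappa x y c)^-1 = kappa'.
Proof.
have kU : kappa x y c \is a GRing.unit.
  apply: Qunit; apply/eqP => k0; have := mul_kappa_kappa'.
  by rewrite k0 mul0r => /esym/eqP; rewrite oner_eq0.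
by split=> //; rewrite -[LHS]mulr1 -mul_kappa_kappa' mulKr.
Qed.

Local Notation f := (\det (charX (qY c))).
Local Notation d := (\det (charX (qX c))).

Let ncinv_a : ncinvmx a = (hx d)^-1 *: map_mx hx (\adj (charX (qX c))).
Proof. rewrite aE; exact: (ncinvmx_adj horner_det_unitX). Qed.

Let ncinv_b : ncinvmx b = (hy f)^-1 *: map_mx hy (\adj (charX (qY c))).
Proof. rewrite bE; exact: (ncinvmx_adj horner_det_unitY). Qed.

Let row_clear (z : Q) e (M : 'M[{poly k}]_n) l :
  horner_alg z e \is a GRing.unit ->
  horner_alg z e * (J *m ((horner_alg z e)^-1 *: map_mx (horner_alg z) M)) 0 l =
  horner_alg z ((map_mx polyC (qj c) *m M) 0 l).
Proof.
move=> eU; rewrite !mxE mulr_sumr rmorph_sum; apply: eq_bigr => r _.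
rewrite rmorphM !mxE /= horner_algC.
by rewrite [_%:A * _]mulr_algl [_%:A * _]mulr_algl -!scalerAr mulVKr.
Qed.

Let col_clear (z : Q) e (M : 'M[{poly k}]_n) l :
  horner_alg z e \is a GRing.unit ->
  (((horner_alg z e)^-1 *: map_mx (horner_alg z) M) *m I) l 0 * horner_alg z e =
  horner_alg z ((M *m map_mx polyC (qi c)) l 0).
Proof.
move=> eU; rewrite !mxE mulr_suml rmorph_sum; apply: eq_bigr => r _.
rewrite !rmorphM !mxE /= horner_algC.
rewrite [_ * _%:A]mulr_algr [_ * _%:A]mulr_algr -!scalerAl.
by rewrite -mulrA -rmorphM mulrC rmorphM mulKr.
Qed.

(** The inverse in y stands to the left of the inverse in x, so f on the left and d on the right
    clear the denominators, and the result is already in normal form. *)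
Lemma kappa_clear : hy f * kappa x y c * hx d =
  hy f * hx d -
  \sum_l hy ((map_mx polyC (qj c) *m \adj (charX (qY c))) 0 l) *
         hx ((\adj (charX (qX c)) *m map_mx polyC (qi c)) l 0).
Proof.
rewrite /kappa mulrBr mulr1 mulrBl; congr (_ - _).
rewrite ncinv_a ncinv_b -[_ *m _ *m map_mx _ (qi c)]mulmxA mxE.
rewrite mulr_sumr mulr_suml; apply: eq_bigr => l _.
rewrite mulrA row_clear; last exact: horner_det_unitY.
by rewrite -mulrA col_clear //; exact: horner_det_unitX.
Qed.

Lemma kappa'_clear : hx d * kappa' * hy f =
  hx d * hy f +
  \sum_l hx ((map_mx polyC (qj c) *m \adj (charX (qX c))) 0 l) *
         hy ((\adj (charX (qY c)) *m map_mx polyC (qi c)) l 0).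
Proof.
rewrite /kappa' mulrDr mulr1 mulrDl; congr (_ + _).
rewrite ncinv_a ncinv_b -[_ *m _ *m map_mx _ (qi c)]mulmxA mxE.
rewrite mulr_sumr mulr_suml; apply: eq_bigr => l _.
rewrite mulrA row_clear; last exact: horner_det_unitX.
by rewrite -mulrA col_clear //; exact: horner_det_unitY.
Qed.
End Kappa.

(** * The numerator of the Baker function *)

Section ClearField.
Variables (k : closedFieldType) (L : fieldType) (emb : {rmorphism k -> L}) (n :
  nat).
Variables (phi : {rmorphism {poly k} -> L}).
Hypothesis phiC : forall t, phi t%:P = emb t.

Lemma map_charX_field (M : 'M[k]_n) :
  map_mx emb M - (phi 'X)%:M = map_mx phi (charX M).
Proof. by apply/matrixP => i j; rewrite !mxE rmorphB rmorphMn phiC. Qed.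

Lemma row_clear_field (u : 'rV[k]_n) (M : 'M[k]_n) l :
  phi (\det (charX M)) != 0 ->
  phi (\det (charX M)) *
    (map_mx emb u *m invmx (map_mx emb M - (phi 'X)%:M)) 0 l =
  phi ((map_mx polyC u *m \adj (charX M)) 0 l).
Proof.
rewrite map_charX_field /invmx unitmxE det_map_mx unitfE => e0; rewrite e0.
rewrite -scalemxAr mxE mulVKf // -map_mx_adj.
have -> : map_mx emb u = map_mx phi (map_mx polyC u).
  by apply/matrixP => i j; rewrite !mxE phiC.
by rewrite -map_mxM mxE.
Qed.

Lemma col_clear_field (u : 'cV[k]_n) (M : 'M[k]_n) l :
  phi (\det (charX M)) != 0 ->
  (invmx (map_mx emb M - (phi 'X)%:M) *m map_mx emb u) l 0 *
    phi (\det (charX M)) =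
  phi ((\adj (charX M) *m map_mx polyC u) l 0).
Proof.
rewrite map_charX_field /invmx unitmxE det_map_mx unitfE => e0; rewrite e0.
rewrite -scalemxAl mxE mulrC mulVKf // -map_mx_adj.
have -> : map_mx emb u = map_mx phi (map_mx polyC u).
  by apply/matrixP => i j; rewrite !mxE phiC.
by rewrite -map_mxM mxE.
Qed.
End ClearField.

Lemma kappa_clear_field (k : closedFieldType) (L : fieldType)
    (emb : {rmorphism k -> L}) (phz phx : {rmorphism {poly k} -> L})
    n (c : quad k n) :
  (forall t, phz t%:P = emb t) -> (forall t, phx t%:P = emb t) ->
  phz (\det (charX (qY c))) != 0 -> phx (\det (charX (qX c))) != 0 ->
  phz (\det (charX (qY c))) *
    (1 - (map_mx emb (qj c) *m invmx (map_mx emb (qY c) - (phz 'X)%:M)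
      *m invmx (map_mx emb (qX c) - (phx 'X)%:M) *m map_mx emb (qi c)) 0 0) *
    phx (\det (charX (qX c))) =
  phz (\det (charX (qY c))) * phx (\det (charX (qX c))) -
  \sum_l phz ((map_mx polyC (qj c) *m \adj (charX (qY c))) 0 l) *
         phx ((\adj (charX (qX c)) *m map_mx polyC (qi c)) l 0).
Proof.
move=> phzC phxC f0 d0; rewrite mulrBr mulr1 mulrBl; congr (_ - _).
rewrite -[_ *m _ *m map_mx _ (qi c)]mulmxA mxE mulr_sumr mulr_suml.
apply: eq_bigr => l _.
by rewrite mulrA row_clear_field // -mulrA col_clear_field.
Qed.

Lemma frac_sub1 (R : idomainType) (psi : {fraction R}) (q v m d : R) :
  tofrac d * (psi - 1) = tofrac m -> tofrac q * psi = tofrac v ->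
  (v - q) * d = q * m.
Proof.
move=> e1 e2; apply: tofrac_inj; rewrite !tofracM tofracB -e1 -e2.
have mulACB (F : comNzRingType) (a b e : F) : (a * b - a) * e = a * (e * (b -
  1)).
  by ring.
exact: mulACB.
Qed.

(** Cross-multiplication compares the representative chosen by [repr] with (v - q) / q; as degrees
    add, the sign of the degree does not depend on the representative. *)
Lemma tends_to_oneE (K : fieldType) (psi : ratfun K) (q v : {poly K}) :
  q != 0 -> tofrac q * psi = tofrac v ->
  tends_to_one psi = (size (v - q)%R < size q)%N.
Proof.
rewrite /tends_to_one; set nn := \n_(_); set dd := \d_(_) => q0 e.
have dd0 : dd != 0 by rewrite denom_ratioP.
have e1 := frac_sub1 (frac_repr (psi - 1)) e; rewrite -/nn -/dd in e1.
have [v0|v0] := eqVneq (v - q) 0.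
  have -> : nn = 0.
    by move/eqP: e1; rewrite v0 mul0r eq_sym mulf_eq0 (negPf q0) => /eqP.
  by rewrite size_poly0 !size_poly_gt0 dd0 v0 size_poly0 size_poly_gt0 q0.
have nn0 : nn != 0.
  apply: contra_eq_neq e1 => ->; rewrite mulr0.
  by rewrite mulf_eq0 (negPf v0) (negPf dd0).
have := congr1 (fun p : {poly K} => size p) e1; rewrite !size_mul // => e2.
have gt0 (p p' : {poly K}) : p != 0 -> (0 < size p + size p')%N.
  by move=> p0; rewrite addn_gt0 size_poly_gt0 p0.
rewrite -(ltn_add2l (size q)) -(prednK (gt0 _ nn q0)) -e2 prednK ?gt0 //.
by rewrite ltn_add2r.
Qed.

Section PsiClear.
Variables (k : closedFieldType) (n : nat) (c : quad k n).
Local Notation f := (\det (charX (qY c))).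
Local Notation d := (\det (charX (qX c))).

(** The link between the two worlds: [ev] sends it to f kappa d in the Weyl algebra, and [symbol]
    sends it to f psi d. *)
Definition kappa_num : {poly {poly k}} :=
  map_poly polyC f * d%:P -
  \sum_l map_poly polyC ((map_mx polyC (qj c) *m \adj (charX (qY c))) 0 l) *
         ((\adj (charX (qX c)) *m map_mx polyC (qi c)) l 0)%:P.

Lemma psi_clear :
  tofrac (map_poly (@ratC k) f) * psi_quad c * tofrac (tofrac d)%:P =
  tofrac (symbol kappa_num) :> ratfun2 k.
Proof.
pose phz : {rmorphism {poly k} -> ratfun2 k} :=
  (@tofrac {poly ratfun k}) \o (map_poly (@ratC k)).
pose phx : {rmorphism {poly k} -> ratfun2 k} :=
  (@tofrac {poly ratfun k}) \o (@polyC (ratfun k)) \o (@tofrac {poly k}).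
pose emb : {rmorphism k -> ratfun2 k} :=
  (@tofrac {poly ratfun k}) \o (@polyC (ratfun k)) \o (@ratC k).
have phzC t : phz t%:P = emb t by rewrite /phz /= map_polyC.
have phxC t : phx t%:P = emb t by [].
have f0 : phz f != 0 by rewrite tofrac_eq0 map_poly_eq0 det_charX_neq0.
have d0 : phx d != 0 by rewrite tofrac_eq0 polyC_eq0 tofrac_eq0 det_charX_neq0.
have -> : psi_quad c = 1 - (map_mx emb (qj c)
   *m invmx (map_mx emb (qY c) - (phz 'X)%:M)
   *m invmx (map_mx emb (qX c) - (phx 'X)%:M) *m map_mx emb (qi c)) 0 0.
  by rewrite /psi_quad /phz /= map_polyX.
etransitivity; first exact: (kappa_clear_field phzC phxC f0 d0).
have symE u v : tofrac (symbol (map_poly polyC u * v%:P)) = phz u * phx v.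
  have -> : symbol (map_poly polyC u * v%:P) = map_poly (@ratC k) u * (tofrac
    v)%:P.
    by rewrite -symbol_ratC /symbol rmorphM /= [map_poly _ v%:P]map_polyC.
  exact: tofracM.
have symB (P1 P2 : {poly {poly k}}) : tofrac (symbol (P1 - P2)) = tofrac
  (symbol P1) - tofrac (symbol P2).
  by rewrite /symbol rmorphB tofracB.
rewrite /kappa_num symB symE; congr (_ - _).
have sym0 : tofrac (symbol (0 : {poly {poly k}})) = 0 :> ratfun2 k by rewrite
  /symbol rmorph0 tofrac0.
have symD (P1 P2 : {poly {poly k}}) : tofrac (symbol (P1 + P2)) = tofrac
  (symbol P1) + tofrac (symbol P2).
  by rewrite /symbol rmorphD tofracD.
rewrite (big_morph (fun P : {poly {poly k}} => tofrac (symbol P)) symD sym0).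
by apply: eq_bigr => l _; rewrite symE.
Qed.

Variable C : adelic_data k.
Hypothesis hC : is_baker C (psi_quad c).

Lemma ad_q_neq0 : ad_q C != 0.
Proof.
rewrite prodf_seq_neq0; apply/allP => l _.
by rewrite expf_neq0 // polyXsubC_eq0.
Qed.

(** With v = q psi, the symbol of q f kappa d is f times d v. As f has coefficients in k, the
    quotient already has coefficients in k[x]; its size is that of q because psi tends to 1. *)
Lemma baker_num : exists Pw : {poly {poly k}},
  [/\ map_poly polyC (ad_q C) * kappa_num = map_poly polyC f * Pw,
      exp_V C (symbol Pw) & size Pw = size (ad_q C)].
Proof.
have [tone [v [ev vV]]] := hC.
have e : symbol (map_poly polyC (ad_q C) * kappa_num) =
         map_poly (@ratC k) f * (tofrac d *: v).
  apply: tofrac_inj; rewrite /symbol rmorphM !tofracM /= -!/(symbol _)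
    symbol_ratC.
  rewrite -psi_clear -mul_polyC tofracM -ev.
  have mulACAC (F : comNzRingType) (a b g e : F) :
    a * (b * g * e) = b * (e * (a * g)) by ring.
  exact: mulACAC.
have f0 : f != 0 by exact: det_charX_neq0.
have [Pw ePw] := symbol_dvd f0 e; exists Pw.
have eP : symbol Pw = tofrac d *: v.
  apply: (@mulfI _ (map_poly (@ratC k) f)); first by rewrite map_poly_eq0.
  by rewrite -e ePw -symbol_ratC /symbol rmorphM.
split=> //; first by rewrite eP; exact: exp_VZ.
have q0 : map_poly (@ratC k) (ad_q C) != 0 by rewrite map_poly_eq0 ad_q_neq0.
rewrite -size_sym eP size_scale; last first.
  by rewrite tofrac_eq0 det_charX_neq0.
move: tone; rewrite (tends_to_oneE q0 ev) => lt.
by rewrite -(size_map_poly (@ratC k)) -[v](subrK (map_poly (@ratC k) (ad_q C)))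
  addrC
  size_polyDl.
Qed.

End PsiClear.

(** * Common denominators and operators with rational coefficients *)

Lemma common_denominator (R : idomainType) s (a : nat -> {fraction R}) :
  exists2 e, e != 0 & exists b : nat -> R,
    forall m, (m < s)%N -> tofrac e * a m = tofrac (b m).
Proof.
elim: s => [|s [e e0 [b eb]]]; first by exists 1;
  [exact: oner_neq0|exists (fun=> 0)].
pose d := \d_(repr (a s)); exists (e * d);
  first by rewrite mulf_neq0 ?denom_ratioP.
exists (fun m => if m == s then e * \n_(repr (a s)) else b m * d) => m.
rewrite ltnS leq_eqVlt; case: (eqVneq m s) => [-> _|_ /= ms].
  by rewrite !tofracM -mulrA frac_repr.
by rewrite !tofracM mulrAC eb.
Qed.

Lemma horner_alg_morph (k : fieldType) (A B : algType k)
    (f : {lrmorphism A -> B}) (z : A) p :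
  horner_alg (f z) p = f (horner_alg z p).
Proof.
elim/poly_ind: p => [|p t IH]; first by rewrite !rmorph0.
rewrite !rmorphD !rmorphM /= !horner_algX !horner_algC IH.
by rewrite linearZ /= rmorph1.
Qed.

Lemma symbolZ (k : closedFieldType) (e : {poly k}) (P : {poly {poly k}}) :
  symbol (e *: P) = tofrac e *: symbol P.
Proof. exact: map_polyZ. Qed.

Lemma symbol_sum (k : closedFieldType) n (F : 'I_n -> {poly {poly k}}) :
  symbol (\sum_i F i) = \sum_i symbol (F i).
Proof. exact: (raddf_sum (map_poly (@tofrac {poly k}))). Qed.

Section DiffOp.
Variable k : fieldType.
Implicit Types (a b : {poly (ratfun k)}) (g : ratfun k).

Definition ratdop a g : ratfun k := \sum_(r < size a) a`_r * iter r (@ddz k) g.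

Lemma ratdop_widen s a g : (size a <= s)%N ->
  ratdop a g = \sum_(r < s) a`_r * iter r (@ddz k) g.
Proof.
move=> le; rewrite /ratdop (big_ord_widen s (fun r => a`_r * iter r (@ddz k) g)
  le).
rewrite big_mkcond /=; apply: eq_bigr => r _.
by case: ltnP => // ge; rewrite nth_default ?mul0r.
Qed.

Lemma ratdopD a b g : ratdop (a + b) g = ratdop a g + ratdop b g.
Proof.
pose s := maxn (size a) (size b).
rewrite !(@ratdop_widen s) ?leq_maxl ?leq_maxr ?size_polyD // -big_split /=.
by apply: eq_bigr => r _; rewrite coefD mulrDl.
Qed.

Lemma ratdopZ e a g : ratdop (e *: a) g = e * ratdop a g.
Proof.
rewrite !(@ratdop_widen (size a)) ?size_scale_leq // mulr_sumr.
by apply: eq_bigr => r _; rewrite coefZ mulrA.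
Qed.

Lemma ratdopC e g : ratdop e%:P g = e * g.
Proof.
by rewrite (@ratdop_widen 1) ?size_polyC ?leq_b1 // big_ord1 coefC eqxx.
Qed.

Lemma ratdopX a g : ratdop (a * 'X) g = ratdop a (ddz g).
Proof.
rewrite (@ratdop_widen (size a).+1); last first.
  by rewrite (leq_trans (size_polyMleq _ _)) // size_polyX addn2.
rewrite big_ord_recl coefMX eqxx mul0r add0r; apply: eq_bigr => r _.
by rewrite /bump /= coefMX -iterSr.
Qed.
End DiffOp.

(** * The ideal of operators from k[z] to W *)

Section Ideal.
Variable k : closedFieldType.
Hypothesis hk : [pchar k] =i pred0.
Variables (A : algType k) (x y : A).
Hypothesis hA : weyl_algebra x y.
Variables (Q : unitAlgType k) (iota : {lrmorphism A -> Q}).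
Hypothesis hQ : quotient_skew_field iota.
Variable rho : A -> ratfun k -> ratfun k.
Hypothesis hrho : weyl_rep x y rho.
Variables (n : nat) (c : quad k n).
Hypothesis hc : cm_eq c.
Variable C : adelic_data k.
Hypothesis hC : is_baker C (psi_quad c).
Implicit Types (a b : A) (h : {poly k}) (P : {poly {poly k}}) (u v : Q).

Local Notation hx := (horner_alg x).
Local Notation hy := (horner_alg y).
Local Notation ev := (ev x y).
Local Notation f := (\det (charX (qY c))).
Local Notation d := (\det (charX (qX c))).
Local Notation q := (ad_q C).
Local Notation kap := (kappa (iota x) (iota y) c).

Lemma iota_inj : injective iota. Proof. by case: hQ. Qed.

Let iotaM a b : iota (a * b) = iota a * iota b. Proof. exact: rmorphM. Qed.

Let iotaB a b : iota (a - b) = iota a - iota b. Proof. exact: rmorphB. Qed.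
Let iotaD a b : iota (a + b) = iota a + iota b. Proof. exact: rmorphD. Qed.
Let iota_sum (F : 'I_n -> A) : iota (\sum_l F l) = \sum_l iota (F l).
Proof. exact: raddf_sum. Qed.

Lemma iota_unit a : a != 0 -> iota a \is a GRing.unit.
Proof.
move=> a0; have [inj u _] := hQ; apply: u.
by apply: contra_neq a0 => e; apply: inj; rewrite e rmorph0.
Qed.

Lemma iota_hy_unit (p : {poly k}) : p != 0 -> iota (hy p) \is a GRing.unit.
Proof.
move=> p0; apply: iota_unit; apply: contra_neq p0.
exact: (hy_eq0 hk hrho).
Qed.

Lemma iota_hx_unit (p : {poly k}) : p != 0 -> iota (hx p) \is a GRing.unit.
Proof.
move=> p0; apply: iota_unit; apply: contra_neq p0.
exact: (hx_eq0 hk hrho).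
Qed.

Let x_injQ p : horner_alg (iota x) p = 0 -> p = 0.
Proof.
rewrite horner_alg_morph -[RHS](rmorph0 iota) => /iota_inj.
exact: (hx_eq0 hk hrho).
Qed.

Let y_injQ p : horner_alg (iota y) p = 0 -> p = 0.
Proof.
rewrite horner_alg_morph -[RHS](rmorph0 iota) => /iota_inj.
exact: (hy_eq0 hk hrho).
Qed.

Let Qunit (u : Q) : u != 0 -> u \is a GRing.unit.
Proof. by have [_ h _] := hQ; exact: h. Qed.

Let xyQ : iota x * iota y - iota y * iota x = 1.
Proof. by rewrite -!rmorphM -rmorphB; case: hA => -> _; rewrite rmorph1. Qed.

Lemma kap_unit : kap \is a GRing.unit.
Proof. by case: (kappa_unit Qunit xyQ hc x_injQ y_injQ). Qed.

Lemma ev_kappa_num : iota (ev (kappa_num c)) = iota (hy f) * kap * iota (hx d).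
Proof.
have := kappa_clear c Qunit x_injQ y_injQ; rewrite !horner_alg_morph => ->.
have evB P1 P2 : ev (P1 - P2) = ev P1 - ev P2.
  apply/eqP; rewrite eq_sym subr_eq -evD; apply/eqP; congr (ev _).
  by rewrite subrK.
rewrite /kappa_num evB (big_morph ev (evD x y) (ev0 x y)).
rewrite iotaB; congr (_ - _); first by rewrite ev_mull evC iotaM.
rewrite iota_sum; apply: eq_bigr => l _.
by rewrite ev_mull evC !horner_alg_morph; exact: iotaM.
Qed.

(* A preserves k[z], so the a in A with a k[z] \subset V form a right ideal. *)
Lemma ideal_mulr P a : exp_V C (symbol P) ->
  exists2 P', ev P * a = ev P' & exp_V C (symbol P').
Proof.
move=> PV; have [P1 ->] := ev_surj hA a;
  have [P' e] := ev_surj hA (ev P * ev P1).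
exists P' => //; apply/(exp_V_sym hk) => h.
have -> : op P' h = op P (op P1 h).
  apply: tofrac_inj; rewrite -!(rho_ev hrho) -e.
  by rewrite (rhoM hrho).
by move: (op P1 h); exact/(exp_V_sym hk).
Qed.

(* The elements u such that u k[z] \subset W = q^{-1} V. *)
Definition hom_ideal (u : Q) : Prop :=
  exists2 P, iota (hy q) * u = iota (ev P) & exp_V C (symbol P).

Lemma hom_ideal_mulr u a : hom_ideal u -> hom_ideal (u * iota a).
Proof.
move=> [P e PV]; have [P' e' P'V] := ideal_mulr a PV; exists P' => //.
by rewrite mulrA e -iotaM e'.
Qed.

Lemma hom_ideal_add u v : hom_ideal u -> hom_ideal v -> hom_ideal (u + v).
Proof.
move=> [P e PV] [P' e' P'V]; exists (P + P').
  by rewrite mulrDr e e' evD iotaD.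
rewrite /symbol rmorphD -[X in exp_V C (X + _)]scale1r; exact: exp_VP.
Qed.

Lemma ad_q_unit : iota (hy q) \is a GRing.unit.
Proof. exact/iota_hy_unit/ad_q_neq0. Qed.

Lemma baker_ev : exists Pw,
  [/\ iota (hy q) * (kap * iota (hx d)) = iota (ev Pw),
     exp_V C (symbol Pw) & size Pw = size q].
Proof.
have [Pw [e PwV sPw]] := baker_num hC; exists Pw; split=> //.
apply: (mulrI (iota_hy_unit (det_charX_neq0 (qY c)))).
have fq : iota (hy f) * iota (hy q) = iota (hy q) * iota (hy f).
  by rewrite -!rmorphM mulrC.
transitivity (iota (hy q * ev (kappa_num c))).
  by rewrite iotaM ev_kappa_num !mulrA fq.
by rewrite -ev_mull e ev_mull iotaM.
Qed.

Lemma hom_ideal_kappa : hom_ideal (kap * iota (hx d)).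
Proof. by have [Pw [e PwV _]] := baker_ev; exists Pw. Qed.

(** The symbol of q u is a k(x)-combination of those of q kappa d y^m. A common denominator s of the
    coefficients only scales symbols, so it becomes the right factor s(x). *)
Lemma hom_ideal_span u : hom_ideal u -> exists2 s, s != 0 &
  exists a, u * iota (hx s) = kap * iota (hx d) * iota a.
Proof.
move=> [P e PV]; have [Pw [ew PwV sPw]] := baker_ev.
have [|m|s [a ea]] := exp_V_span hk (C := C) (w := fun m => symbol (iter m (@zr
  k) Pw)) _ _ PV.
- elim=> // m IH; apply/(exp_V_sym hk) => h; rewrite iterS -op_mulX.
  by move: ('X * h); exact/(exp_V_sym hk).
- elim: m => [|m IH]; first by rewrite size_sym sPw addn0.
  rewrite size_sym iterS size_zr -?size_sym ?IH ?addnS //.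
  by rewrite -size_poly_gt0 -size_sym IH addn_gt0 size_poly_gt0 ad_q_neq0.
have [t t0 [b eb]] := common_denominator s a.
have eP : t *: P = \sum_(m < s) b m *: iter m (@zr k) Pw.
  apply: symbol_inj; rewrite symbol_sum symbolZ ea scaler_sumr;
    apply: eq_bigr => m _.
  by rewrite scalerA eb // symbolZ.
exists t => //; exists (\sum_(m < s) y ^+ m * hx (b m)).
apply: (mulrI ad_q_unit); rewrite !mulrA e -mulrA -[in RHS]mulrA.
rewrite [in RHS]mulrA [in RHS]mulrA -[_ * kap * _]mulrA ew -!iotaM -evZ eP.
congr (iota _); rewrite (big_morph ev (evD x y) (ev0 x y)).
rewrite mulr_sumr; apply: eq_bigr => m _; rewrite evZ mulrA; congr (_ * _).
elim: (nat_of_ord m) => [|i IH]; first by rewrite mulr1.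
by rewrite iterS (ev_zr hA) IH exprSr mulrA.
Qed.

Lemma hom_ideal_f : hom_ideal (iota (hy f)).
Proof.
have [Pw [ew PwV _]] := baker_ev.
have d0 : d != 0 := det_charX_neq0 _.
pose t0 : A := hx d * hy f + \sum_l
  hx ((map_mx polyC (qj c) *m \adj (charX (qX c))) 0 l) *
  hy ((\adj (charX (qY c)) *m map_mx polyC (qi c)) l 0).
have et0 : iota t0 = iota (hx d) * kap^-1 * iota (hy f).
  have [_ ->] := kappa_unit Qunit xyQ hc x_injQ y_injQ.
  have := kappa'_clear c Qunit x_injQ y_injQ; rewrite !horner_alg_morph => ->.
  rewrite /t0 iotaD iotaM iota_sum; congr (_ + _).
  by apply: eq_bigr => l _; rewrite !horner_alg_morph; exact: iotaM.
(* The square of d is needed because t0 is d kappa^{-1} f: one factor d cancels, the other remains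
   in f s = kappa d t. *)
have [s s0 [t et]] := ore_x hA t0 (mulf_neq0 d0 d0).
have e1 : iota (hy f) * iota (hx s) = kap * iota (hx d) * iota t.
  have dk : iota (hx d) * kap^-1 \is a GRing.unit.
    by rewrite unitrMl ?unitrV ?kap_unit ?iota_hx_unit.
  apply: (mulrI dk); rewrite mulrA -et0 -iotaM et -!mulrA mulKr ?kap_unit //.
  by rewrite iotaM rmorphM iotaM -!mulrA.
have [P' e' P'V] := ideal_mulr t PwV.
exists (map_poly polyC (q * f)); first by rewrite ev_hy rmorphM iotaM.
have eP' : P' = s *: map_poly polyC (q * f).
  apply: (ev_inj hk hrho); rewrite -e' evZ ev_hy; apply: iota_inj.
  by rewrite !iotaM -ew [hy (_ * _)]rmorphM iotaM -!mulrA e1 !mulrA.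
have ts0 : tofrac s != 0 :> ratfun k by rewrite tofrac_eq0.
have := exp_VZ (tofrac s)^-1 P'V; rewrite eP' symbolZ scalerA.
by rewrite mulVf // scale1r.
Qed.

Local Notation My := (M_y x y iota c).

Lemma M_y_mulr u a : My u -> My (u * iota a).
Proof.
by move=> [a1 [b1 ->]]; exists (a1 * a), (b1 * a);
  rewrite mulrDl -!mulrA -!iotaM.
Qed.

Lemma M_y_sub u v : My u -> My v -> My (u - v).
Proof.
move=> [a1 [b1 ->]] [a2 [b2 ->]]; exists (a1 - a2), (b1 - b2).
by rewrite !iotaB !mulrBr opprD addrACA.
Qed.

Lemma M_y_hom_ideal u : My u -> hom_ideal u.
Proof.
move=> [a [b ->]]; apply: hom_ideal_add; apply: hom_ideal_mulr;
  first exact: hom_ideal_f.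
exact: hom_ideal_kappa.
Qed.

Lemma hom_ideal_torsion u :
  hom_ideal u -> exists2 p, p != 0 & My (u * iota (hy p)).
Proof.
move=> [P e _]; have fq0 : q * f != 0.
  by rewrite mulf_neq0 ?ad_q_neq0 // det_charX_neq0.
(* Applied with q f, so that q u p(y) = q f b; cancelling q leaves u p(y) in f A. *)
have [p p0 [b eb]] := ore_y hA (ev P) fq0; exists p => //.
exists b, 0; rewrite rmorph0 mulr0 addr0; apply: (mulrI ad_q_unit).
by rewrite mulrA e -iotaM eb iotaM rmorphM iotaM -mulrA.
Qed.

(* As p' = (x - l) p - p (x - l), the polynomials p(y) with u p in M_y are
   stable under differentiation. *)
Lemma M_y_descent u (l : k) (p : {poly k}) : p != 0 -> My (u * iota (hy p)) ->
  My (u * iota (x - l%:A)) -> My u.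
Proof.
move=> p0 up ul.
have [|t t0 ut] := poly_descent (T := fun r => My (u * iota (hy r))) hk p0 up.
  move=> r ur; have -> : u * iota (hy r^`()) =
      u * iota (x - l%:A) * iota (hy r) - u * iota (hy r) * iota (x - l%:A).
    rewrite -!mulrA -mulrBr -!iotaM -iotaB; congr (_ * iota _).
    rewrite mulrBl mulrBr (x_hy hA) mulr_algl mulr_algr.
    by rewrite opprB addrA subrK addrAC subrr add0r.
  by apply: M_y_sub; exact: M_y_mulr.
have := M_y_mulr (t^-1)%:A ut; rewrite horner_algC -mulrA -iotaM.
by rewrite mulr_algr scalerA mulVf // scale1r rmorph1 mulr1.
Qed.

Lemma hom_ideal_M_y u : hom_ideal u -> My u.
Proof.
move=> uN; have [s s0 [a ea]] := hom_ideal_span uN.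
have us : My (u * iota (hx s)) by exists 0, a; rewrite rmorph0 mulr0 add0r.
have [r es] := closed_field_poly_normal s.
have : My (u * iota (hx (\prod_(z <- r) ('X - z%:P)))).
  have -> : hx (\prod_(z <- r) ('X - z%:P)) = hx s * (lead_coef s)^-1%:A.
    rewrite mulr_algr {2}es -mul_polyC rmorphM /= horner_algC mulr_algl scalerA.
    rewrite mulVf ?scale1r //.
    by rewrite lead_coef_eq0.
  by rewrite iotaM mulrA; exact: M_y_mulr.
elim: r {s s0 us es a ea} => [|l r IH]; first by rewrite big_nil !rmorph1 mulr1.
rewrite big_cons mulrC rmorphM iotaM mulrA => h; apply: IH.
have [p p0 up] := hom_ideal_torsion (hom_ideal_mulr (hx (\prod_(j <- r) ('X -
  j%:P))) uN).
apply: (M_y_descent (l := l) p0 up).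
by have -> : x - l%:A = hx ('X - l%:P) by rewrite rmorphB /= horner_algX
  horner_algC.
Qed.

(** The operator p^{-1} [rho a] for u = p(y)^{-1} a. By [phiE] the choice of p and a is immaterial;
    an element of Q without such a form is sent to 0. *)
Definition phi u : ratfun k -> ratfun k :=
  let: pa := xget (1, 0)
    [set pa : {poly k} * A | pa.1 != 0 /\ iota (hy pa.1) * u = iota
      pa.2]%classic in
  fun g => rho pa.2 g / tofrac pa.1.

Lemma phiE u (p : {poly k}) a g : p != 0 -> iota (hy p) * u = iota a ->
  phi u g = rho a g / tofrac p.
Proof.
move=> p0 e; rewrite /phi; set S := [set pa | _]%classic.
have : S (xget (1, 0) S) by apply: (@xgetPex _ _ S); exists (p, a).
case: (xget _ _) => p1 a1 /= [p10 e1].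
have e2 : hy p * a1 = hy p1 * a.
  by apply: iota_inj; rewrite !iotaM -e1 -e !mulrA -!iotaM -!rmorphM mulrC.
have := congr1 (rho^~ g) e2; rewrite /= !(rhoM hrho) !(rho_hy hrho) => e3.
apply/eqP; rewrite eqr_div ?tofrac_eq0 //.
by rewrite mulrC e3 mulrC.
Qed.

Lemma rho_diff_op P :
  exists al : {poly (ratfun k)}, forall g, rho (ev P) g = ratdop al g.
Proof.
elim/poly_ind: P => [|P e [a ea]].
  by exists 0 => g; rewrite ev0 (rho0 hrho) -polyC0 ratdopC mul0r.
have [b eb] : exists b : {poly (ratfun k)}, forall g, rho (hx e) g = ratdop b g.
  elim/poly_ind: e => [|e t [b eb]].
    by exists 0 => g; rewrite rmorph0 (rho0 hrho) -polyC0 ratdopC mul0r.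
  exists (b * 'X + (ratC t)%:P) => g.
  rewrite horner_alg_cons (rhoD hrho) (rhoM hrho) (rho_x hrho) eb.
  by rewrite (rho_alg hrho) ratdopD ratdopX ratdopC.
exists (ratX k *: a + b) => g.
by rewrite ev_cons (rhoD hrho) (rhoM hrho) ea (rho_y hrho) ratdopD ratdopZ eb.
Qed.

Lemma phi_hom_ideal u : hom_ideal u -> cannings_holland (ad_W C) (phi u).
Proof.
move=> [P e PV]; have pE := phiE _ (ad_q_neq0 C) e; split.
  have [a ea] := rho_diff_op P; exists ((tofrac q)^-1 *: a) => g.
  by rewrite pE ea -/(ratdop _ _) ratdopZ mulrC.
move=> h; rewrite pE (rho_ev hrho); exists (op P h) => //.
by move: h; exact/(exp_V_sym hk).
Qed.

(** Clearing the denominators of D by e gives u = e(y)^{-1} a. As D maps k[z] to q^{-1} V, e divides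
    q times every value of a on k[z], hence divides the operator q a itself by [op_dvd]; so q u lies
    in A. *)
Lemma phi_surj D :
  cannings_holland (ad_W C) D -> exists2 u, hom_ideal u & phi u = D.
Proof.
move=> [[al eD] DW].
have [e e0 [b eb]] := common_denominator (size al) (nth 0 al).
pose a := \sum_(r < size al) hy (b r) * x ^+ r.
have rx r g : rho (x ^+ r) g = iter r (@ddz k) g.
  elim: r => [|r IH]; last by rewrite exprS (rhoM hrho) IH (rho_x hrho).
  by rewrite expr0 -[1 : A]scale1r (rho_alg hrho) rmorph1 mul1r.
have ra g : rho a g = tofrac e * D g.
  rewrite (rho_sum hrho) eD mulr_sumr; apply: eq_bigr => r _.
  by rewrite (rhoM hrho) (rho_hy hrho) rx mulrA eb.
have [P eP] := ev_surj hA a.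
pose u := (iota (hy e))^-1 * iota a.
have ua : iota (hy e) * u = iota a by rewrite mulVKr ?iota_hy_unit.
exists u; last first.
  by apply/funext => g; rewrite (phiE _ e0 ua) ra mulrC mulKf ?tofrac_eq0.
have opP h : exists2 v, ad_V C v & q * op P h = e * v.
  have [v vV ev'] := DW h; exists v => //; apply: tofrac_inj.
  rewrite !tofracM -(rho_ev hrho) -eP ra -ev' mulrCA.
  by congr (_ * _); rewrite mulrC divfK // tofrac_eq0 ad_q_neq0.
have [|P1 eP1] := @op_dvd _ hk e (map_poly polyC q * P) e0.
  by move=> h; rewrite op_mull; have [v _ ->] := opP h; exact: dvdp_mulIl.
exists P1.
  apply: (mulrI (iota_hy_unit e0)); rewrite -iotaM -ev_mull -eP1 ev_mull -eP.
  by rewrite iotaM -ua !mulrA -!iotaM -!rmorphM mulrC.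
apply/(exp_V_sym hk) => h; have [v vV ev'] := opP h.
suff -> : op P1 h = v by [].
by apply: (mulfI e0); rewrite -ev' -!op_mull eP1.
Qed.

Lemma phi_inj u v : hom_ideal u -> hom_ideal v -> phi u = phi v -> u = v.
Proof.
move=> [P e _] [P' e' _] uv; apply: (mulrI ad_q_unit); rewrite e e'.
suff -> : P = P' by [].
have opE h : op P h = op P' h.
  apply: tofrac_inj; have := congr1 (fun g => g (tofrac h)) uv.
  rewrite (phiE _ (ad_q_neq0 C) e) (phiE _ (ad_q_neq0 C) e') !(rho_ev hrho).
  by apply: mulIf; rewrite invr_eq0 tofrac_eq0 ad_q_neq0.
apply/eqP; rewrite -subr_eq0; apply/eqP/(op_eq0 hk) => h.
have -> : P - P' = P + (-1)%:P *: P' by rewrite polyCN polyC1 scaleN1r.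
by rewrite opD opZ dopC opE scaleN1r linearN subrr.
Qed.

Lemma phiD u v g :
  hom_ideal u -> hom_ideal v -> phi (u + v) g = phi u g + phi v g.
Proof.
move=> [P e _] [P' e' _].
have q0 := ad_q_neq0 C.
rewrite (phiE _ q0 e) (phiE _ q0 e') -mulrDl -(rhoD hrho).
by apply: phiE => //; rewrite mulrDr e e' iotaD.
Qed.

Lemma phiM u a g : hom_ideal u -> phi (u * iota a) g = phi u (rho a g).
Proof.
move=> [P e _]; rewrite (phiE _ (ad_q_neq0 C) e) -(rhoM hrho).
by apply: phiE; [exact: ad_q_neq0 | rewrite mulrA e iotaM].
Qed.

Lemma ideal_iso_y : right_iso iota rho My (cannings_holland (ad_W C)).
Proof.
exists phi; split=> [|m m' /M_y_hom_ideal mN /M_y_hom_ideal m'N g|m a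
  /M_y_hom_ideal mN g].
- split=> [m /M_y_hom_ideal /phi_hom_ideal //|m m'|D /phi_surj[u /hom_ideal_M_y
  uM <-]]; last by exists u.
  by rewrite !inE => /M_y_hom_ideal mN /M_y_hom_ideal m'N; exact: phi_inj.
- exact: phiD.
- exact: phiM.
Qed.

Lemma ideal_iso_x :
  right_iso iota rho (M_x x y iota c) (cannings_holland (ad_W C)).
Proof.
have MxE m : M_x x y iota c m <-> My (kap * m).
  split=> [[a [b ->]]|[a [b e]]]; exists b, a.
    by rewrite mulrDr !mulrA mulrV ?kap_unit // mul1r addrC.
  rewrite -[m](mulKr kap_unit) e mulrDr !mulrA mulVr ?kap_unit // mul1r.
  by rewrite addrC.
exists (fun m => phi (kap * m)); split.
- split=> [m /MxE/M_y_hom_ideal/phi_hom_ideal //|m m'|D /phi_surj[u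
  /hom_ideal_M_y uM <-]].
    rewrite !inE => /MxE/M_y_hom_ideal mN /MxE/M_y_hom_ideal m'N /(phi_inj mN
      m'N).
    exact: (mulrI kap_unit).
  by exists (kap^-1 * u); [apply/MxE|]; rewrite mulVKr ?kap_unit.
- move=> m m' /MxE/M_y_hom_ideal mN /MxE/M_y_hom_ideal m'N g; rewrite mulrDr;
  exact: phiD.
- move=> m a /MxE/M_y_hom_ideal mN g; rewrite mulrA; exact: phiM.
Qed.
End Ideal.
(** * Existence of W *)

Section MatrixPoly.
Variable k : fieldType.

Lemma size_det (n : nat) (M : 'M[{poly k}]_n) :
  (forall i j, size (M i j) <= 2)%N -> (size (\det M) <= n.+1)%N.
Proof.
move=> sM; apply: leq_trans (size_sum _ _ _) _; apply/bigmax_leqP => s _.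
rewrite size_Msign; apply: leq_trans (size_prod_leq _ _) _.
rewrite leq_subLR card_ord addnS ltnS.
apply: (@leq_trans (\sum_(i < n) 2)); first by apply: leq_sum.
by rewrite sum_nat_const card_ord muln2 addnn.
Qed.

Definition derivmx m n (M : 'M[{poly k}]_(m, n)) := map_mx (@deriv k) M.

Lemma derivmxM m n r (M : 'M[{poly k}]_(m, n)) (N : 'M[{poly k}]_(n, r)) :
  derivmx (M *m N) = derivmx M *m N + M *m derivmx N.
Proof.
apply/matrixP => i j; rewrite !mxE linear_sum -big_split /=.
by apply: eq_bigr => l _; rewrite derivM !mxE.
Qed.

Lemma derivmxC m n (M : 'M[k]_(m, n)) : derivmx (map_mx polyC M) = 0.
Proof. by apply/matrixP => i j; rewrite !mxE derivC. Qed.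
End MatrixPoly.

(** * Identities for the resolvent of Y *)

Section Resolvent.
Variables (k : closedFieldType) (n : nat) (c : quad k n).
Hypothesis hc : cm_eq c.
Local Notation "M ^%" := (map_mx polyC M) (at level 2).
Local Notation b := (charX (qY c)).
Local Notation f := (\det b).
Local Notation A := (\adj b).

Lemma size_f : size f = n.+1.
Proof.
have -> : b = - char_poly_mx (qY c) by rewrite /charX /char_poly_mx opprB.
by rewrite -scaleN1r detZ size_Msign -[\det _]/(char_poly _) size_char_poly.
Qed.

Lemma size_A i j : (size (A i j) <= n)%N.
Proof.
rewrite mxE /cofactor size_Msign.
case: n c i j => [|n'] c' i j; first by case: i.
apply: size_det => i' j'; rewrite !mxE.
apply: leq_trans (size_polyD _ _) _; rewrite size_polyN geq_max.
by rewrite (leq_trans (size_polyC_leq1 _)) //; case: eqP;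
  rewrite ?size_polyX ?size_poly0.
Qed.

Lemma bA : b *m A = f%:M. Proof. exact: mul_mx_adj. Qed.
Lemma Ab : A *m b = f%:M. Proof. exact: mul_adj_mx. Qed.

Lemma derivmx_b : derivmx b = - 1%:M.
Proof.
apply/matrixP => i j; rewrite !mxE derivB derivC sub0r derivMn derivX.
by case: eqP.
Qed.

(** With R = (Y - z)^{-1} and A = f R, this is R' = R^2 multiplied by f^2. *)
Lemma A_sqr : A *m A = f *: derivmx A - f^`() *: A.
Proof.
have e : derivmx A *m b = A + f^`()%:M.
  have := congr1 (@derivmx k n n) Ab; rewrite derivmxM derivmx_b mulmxN mulmx1.
  have -> : derivmx f%:M = f^`()%:M :> 'M_n.
    by apply/matrixP => i j; rewrite !mxE; case: eqP; rewrite ?mulr0n ?deriv0.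
  by move=> <-; rewrite addrC subrK.
have := congr1 (mulmx^~ A) e; rewrite /= mulmxDl -mulmxA bA mul_scalar_mx.
by rewrite mul_mx_scalar => ->; rewrite addrK.
Qed.

Lemma ij_eq : (qi c)^% *m (qj c)^% = 1%:M + (qX c)^% *m b - b *m (qX c)^%.
Proof.
rewrite -map_mxM -hc /charX mulmxBr mulmxBl map_mxD map_mxB !map_mxM map_mx1.
by rewrite mul_mx_scalar mul_scalar_mx opprB -[RHS]addrA subrKA addrC.
Qed.

(** This is R i j R = R' + R X - X R, for R = (Y - z)^{-1}, multiplied by f^2. *)
Lemma AijA : A *m (qi c)^% *m (qj c)^% *m A =
  f *: derivmx A - f^`() *: A + f *: (A *m (qX c)^%) - f *: ((qX c)^% *m A).
Proof.
rewrite -[A *m _ *m _]mulmxA ij_eq mulmxBr mulmxDr mulmx1 mulmxBl mulmxDl A_sqr.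
congr (_ + _ - _).
  by rewrite !mulmxA -mulmxA bA mul_mx_scalar.
by rewrite !mulmxA Ab mul_scalar_mx -scalemxAl.
Qed.
End Resolvent.

(** * Functionals at a root of det(Y - z) *)

Section LocalFunctionals.
Variables (k : closedFieldType) (n' : nat).
Hypothesis hk : [pchar k] =i pred0.
Local Notation n := n'.+1.
Variable c : quad k n.
Hypothesis hc : cm_eq c.
Local Notation "M ^%" := (map_mx polyC M) (at level 2).
Local Notation X := (qX c).
Local Notation Y := (qY c).
Local Notation b := (charX Y).
Local Notation f := (\det b).
Local Notation A := (\adj b).
Implicit Types (g h p : {poly k}) (v : 'rV[k]_n).

Lemma f_neq0 : f != 0. Proof. exact: det_charX_neq0. Qed.

Lemma horner_mx_f : horner_mx Y f = 0.
Proof.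
have -> : f = (-1) ^+ n * char_poly Y.
  have -> : b = - char_poly_mx Y by rewrite /charX /char_poly_mx opprB.
  by rewrite -scaleN1r detZ.
by rewrite rmorphM /= Cayley_Hamilton mulr0.
Qed.

Lemma horner_mx_mod g h : f %| g - h -> horner_mx Y g = horner_mx Y h.
Proof.
move=> /dvdpP[r e]; apply/eqP; rewrite -subr_eq0 -rmorphB e rmorphM /=.
by rewrite horner_mx_f mulr0.
Qed.

(* Modulo f, the variable z acts on adj(Y - z) as Y. *)
Lemma horner_A g : exists N, g *: A - (horner_mx Y g)^% *m A = f *: N.
Proof.
suff [N eN] : exists N, g%:M - (horner_mx Y g)^% = N *m b.
  exists N; rewrite -mul_scalar_mx -mulmxBl eN -mulmxA (bA c).
  by rewrite mul_mx_scalar.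
elim/poly_ind: g => [|g t [N eN]].
  exists 0; rewrite [horner_mx Y 0]rmorph0 mul0mx; apply/matrixP => i j.
  by rewrite !mxE mul0rn subr0.
exists (N *m Y^% - g%:M).
have -> : (horner_mx Y (g * 'X + t%:P))^% = (horner_mx Y g)^% *m Y^% + t%:P%:M.
  rewrite rmorphD rmorphM /= horner_mx_X horner_mx_C map_mxD map_mxM.
  by congr (_ + _); apply/matrixP => i j; rewrite !mxE; case: eqP.
have -> : (g * 'X + t%:P)%:M = g%:M *m 'X%:M + t%:P%:M :> 'M[{poly k}]_n.
  by rewrite rmorphD /= scalar_mxM.
have bY : b *m Y^% = Y^% *m b.
  by rewrite /charX mulmxBl mulmxBr mul_mx_scalar mul_scalar_mx.
rewrite mulmxBl -mulmxA -bY mulmxA -eN mulmxBl /charX mulmxBr.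
by rewrite opprD addrACA subrr addr0 opprB [RHS]addrC subrKA.
Qed.

(* The residue of g / f^2 at infinity, up to a constant factor. *)
Definition resinf g : k := (g %% f ^+ 2)`_(2 * n).-1.

Lemma size_f2 : size (f ^+ 2) = (2 * n).+1.
Proof.
have := size_exp f 2; rewrite (size_f c) /= => e; rewrite mulnC -e prednK //.
by rewrite size_poly_gt0 expf_neq0 // f_neq0.
Qed.

Lemma resinfD g h : resinf (g + h) = resinf g + resinf h.
Proof. by rewrite /resinf modpD coefD. Qed.

Lemma resinfZ t g : resinf (t *: g) = t * resinf g.
Proof. by rewrite /resinf modpZl coefZ. Qed.

Lemma resinf_dvd g : f ^+ 2 %| g -> resinf g = 0.
Proof. by move=> /modp_eq0P e; rewrite /resinf e coef0. Qed.

Lemma resinfN g : resinf (- g) = - resinf g.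
Proof. by rewrite -scaleN1r resinfZ mulN1r. Qed.

Lemma resinfB g h : resinf (g - h) = resinf g - resinf h.
Proof. by rewrite resinfD resinfN. Qed.

(* The derivative of h / f has no residue. *)
Lemma resinf_deriv h : resinf (f * h^`() - f^`() * h) = 0.
Proof.
rewrite {1 2}(divp_eq h f); set h1 := h %/ f; set h0 := h %% f.
have -> : f * (h1 * f + h0)^`() - f^`() * (h1 * f + h0) =
    f ^+ 2 * h1^`() + (f * h0^`() - f^`() * h0).
  by rewrite derivD derivM; ring.
rewrite resinfD resinf_dvd ?dvdp_mulIl // add0r.
have sh0 : (size h0 <= n)%N.
  by have := ltn_modp h f; rewrite f_neq0 (size_f c) ltnS.
have sd p m : (size p <= m.+1)%N -> (size p^`() <= m)%N.
  have [->|p0 sp] := eqVneq p 0; first by rewrite deriv0 size_poly0.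
  by rewrite -ltnS; apply: leq_trans (lt_size_deriv p0) sp.
have s : (size (f * h0^`() - f^`() * h0)%R <= (2 * n).-1)%N.
  apply: leq_trans (size_polyD _ _) _; rewrite size_polyN geq_max.
  rewrite mul2n -addnn; apply/andP; split.
    apply: leq_trans (size_polyMleq _ _) _; rewrite (size_f c) !addSn /=.
    by rewrite -addnS leq_add2l ltnS; exact: sd.
  apply: leq_trans (size_polyMleq _ _) _; rewrite -!subn1; apply: leq_sub2r.
  by apply: leq_add => //; apply: sd; rewrite (size_f c).
rewrite /resinf modp_small; first by rewrite nth_default.
by rewrite size_f2 ltnS (leq_trans s) // leq_pred.
Qed.

(** A suitable power of z moves the leading coefficient of the remainder of g into the top position,
    the one read by [resinf]. *)
Lemma resinf_nondeg g : (forall h, resinf (g * h) = 0) -> f ^+ 2 %| g.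
Proof.
move=> g0; apply/modp_eq0P; set r := g %% f ^+ 2; apply/eqP/negPn/negP => r0.
have sr : (size r <= 2 * n)%N.
  by have := ltn_modp g (f ^+ 2); rewrite expf_neq0 ?f_neq0 // size_f2 ltnS.
pose s := (2 * n - size r)%N.
have := g0 'X^s; rewrite {1}(divp_eq g (f ^+ 2)) mulrDl resinfD -mulrA mulrCA.
rewrite resinf_dvd ?dvdp_mulIl // add0r -/r /resinf modp_small; last first.
  by rewrite size_mulXn // size_f2 subnK.
have -> : ((2 * n).-1 = (size r).-1 + s)%N.
  by rewrite addnC -[in LHS](subnK sr) -/s -!subn1 addnBA // size_poly_gt0.
rewrite coefMXn ltnNge leq_addl /= addnK -lead_coefE => /eqP.
by rewrite lead_coef_eq0 (negPf r0).
Qed.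

(* e is the idempotent of k[z]/(f^2) attached to the root l of f, so
   g |-> resinf (e g) only depends on g near l. *)
Variables (l : k) (m : nat) (f0 e : {poly k}).
Local Notation t := ('X - l%:P).
Hypotheses (m_gt0 : (0 < m)%N) (fE : f = t ^+ m * f0) (f0l : f0.[l] != 0).
Hypotheses (e1 : t ^+ (2 * m) %| e - 1) (e0 : f0 ^+ 2 %| e).

Let tf0 s r : coprimep (t ^+ s) (f0 ^+ r).
Proof.
apply/coprimep_expl/coprimep_expr; rewrite coprimep_sym coprimep_XsubC.
exact: f0l.
Qed.

Lemma e_idem : f ^+ 2 %| e * (e - 1).
Proof. by rewrite fE exprMn -exprM mulnC mulrC dvdp_mul. Qed.

Lemma m_le : (m <= n)%N.
Proof.
rewrite -ltnS -(size_f c) fE; have f00 : f0 != 0.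
  by apply: contraNneq f0l => ->; rewrite horner0.
rewrite size_mul ?expf_neq0 ?polyXsubC_eq0 // size_exp_XsubC addSn /=.
by rewrite -addn1 leq_add2l size_poly_gt0.
Qed.

Lemma e_tn : f ^+ 2 %| e * t ^+ (2 * n).
Proof.
rewrite fE exprMn -exprM mulnC mulrC dvdp_mul // dvdp_exp2l //.
by rewrite leq_mul2l m_le orbT.
Qed.

(** Being 1 to high order at l and divisible by the square of f0, e is constant modulo f up to first
    order; this lets e pass through a derivative inside a residue. *)
Lemma e_deriv : f %| e^`().
Proof.
rewrite fE Gauss_dvdp; last by have := tf0 m 1; rewrite expr1.
apply/andP; split.
  have [u eu] := dvdpP _ _ e1.
  have -> : e^`() = (e - 1)^`() by rewrite derivB derivC subr0.
  rewrite eu mul2n -addnn exprD mulrCA derivM dvdp_add //.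
    by rewrite dvdp_mull // dvdp_mull.
  by rewrite dvdp_mulr.
have [u ->] := dvdpP _ _ e0; rewrite expr2 mulrA derivM dvdp_add //.
  by rewrite dvdp_mull.
by rewrite -mulrA dvdp_mull // dvdp_mulr.
Qed.

Lemma taylor_split N h : exists (a : nat -> k) r,
  h = \sum_(i < N) a i *: t ^+ i + t ^+ N * r.
Proof.
elim: N => [|N [a [r eh]]].
  by exists (fun=> 0), h; rewrite big_ord0 add0r expr0 mul1r.
have /factor_theorem[r' er'] : root (r - r.[l]%:P) l.
  by rewrite /root !hornerE subrr.
exists (fun i => if i == N then r.[l] else a i), r'.
rewrite big_ord_recr /= eqxx {1}eh -addrA; congr (_ + _).
  by apply: eq_bigr => i _; rewrite (ltn_eqF (ltn_ord i)).
by rewrite -{1}[r](subrK r.[l]%:P) er' exprSr -mul_polyC; ring.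
Qed.

(** Coordinates of g |-> [resinf (G * g)] as a functional at l. The length 2n, and not 2m, is common
    to all roots, as [ad_ord] requires. *)
Definition lfun (G : {poly k}) : 'rV[k]_(2 * n) :=
  \row_r (resinf (G * t ^+ r) / (r`!)%:R).

(** Both sides vanish on multiples of (z - l)^{2n} and agree on the lower powers of z - l. *)
Lemma functional_lfun G h : f ^+ 2 %| G * t ^+ (2 * n) ->
  functional (lfun G) l h = resinf (G * h).
Proof.
move=> Gt; have fE0 N (w : 'rV[k]_N) g : functional w l g = twval 0 w l g.
  apply: eq_bigr => r _; congr (_ * _.[l]).
  elim: (nat_of_ord r) => [|i IH]; first by rewrite derivn0.
  by rewrite derivnS IH iterS {2}/twd scale0r addr0.
have [a [r ->]] := taylor_split (2 * n) h.
rewrite fE0 addrC -[_ * r]scale1r twvalP twval_dvd ?dvdp_mulIl // mulr0 add0r.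
have Lr : resinf (G * (t ^+ (2 * n) * r)) = 0 by rewrite mulrA resinf_dvd //
  dvdp_mulr.
rewrite mulrDr resinfD scale1r Lr add0r -fE0.
have resinf_sum (I : finType) (F : I -> {poly k}) : resinf (\sum_i F i) =
  \sum_i resinf (F i).
  apply: (big_morph resinf resinfD); by rewrite resinf_dvd ?dvdp0.
have fs N (w : 'rV[k]_N) (I : finType) (F : I -> {poly k}) :
    functional w l (\sum_i F i) = \sum_i functional w l (F i).
  rewrite /functional exchange_big; apply: eq_bigr => i _ /=.
  by rewrite raddf_sum horner_sum mulr_sumr.
rewrite mulr_sumr resinf_sum fs; apply: eq_bigr => i _.
rewrite -scalerAr resinfZ /functional (bigD1 i) //= big1 ?addr0 => [|j ji].
  rewrite derivnZ hornerZ horner_derivn_XsubC eqxx mulr1n mxE mulrCA divfK //.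
  exact: fact_neq0.
rewrite -val_eqE /= in ji.
by rewrite derivnZ hornerZ horner_derivn_XsubC (negPf ji) mulr0n !mulr0.
Qed.

(* f (p + v (Y - z)^{-1} i), whose residue pairing at l with W vanishes
   under the condition below. *)
Definition dual_num p v : {poly k} := p * f + (v^% *m A *m (qi c)^%) 0 0.

(** [horner_mx Y e] is the projector to the generalized eigenspace of Y for l. *)
Definition dual_cond p v : Prop :=
  (v *m X - qj c *m horner_mx Y p) *m horner_mx Y e = 0.

(** The conclusion says that (v X - p j)(Y - z)^{-1} has no pole at l. Modulo f, e and p e act on A
    as polynomials in Y, which turns this into the matrix condition. *)
Lemma dual_cond_dvd p v : dual_cond p v ->
  exists N, e *: (((v *m X)^% - p *: (qj c)^%) *m A) = f *: N.
Proof.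
move=> cond; have [N1 eN1] := horner_A e; have [N2 eN2] := horner_A (p * e).
exists ((v *m X)^% *m N1 - (qj c)^% *m N2).
have E1 : e *: A = (horner_mx Y e)^% *m A + f *: N1.
  by rewrite -eN1 addrC subrK.
have E2 : (p * e) *: A = (horner_mx Y (p * e))^% *m A + f *: N2.
  by rewrite -eN2 addrC subrK.
have condA : (v *m X)^% *m ((horner_mx Y e)^% *m A) =
    (qj c)^% *m ((horner_mx Y (p * e))^% *m A).
  rewrite !mulmxA -!map_mxM; congr (_^% *m _); move/eqP: cond.
  by rewrite mulmxBl subr_eq0 => /eqP ->; rewrite rmorphM /= mulmxA.
rewrite mulmxBl scalerBr -scalemxAl scalerA [e * p]mulrC !scalemxAr E1 E2.
by rewrite !mulmxDr condA opprD addrACA subrr add0r -!scalemxAr scalerBr.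
Qed.

(** Let R = (Y - z)^{-1}. Substituting g i = X eta - eta' and R i j R = R' + R X - X R gives (p + v
    R i)(g - j R eta) = p g - (v R eta)' + (v X - p j) R eta: a total derivative and terms without
    pole at l. *)
Lemma resinf_dual_num p v (eta : 'cV[{poly k}]_n) g : dual_cond p v ->
  (qX c)^% *m eta - derivmx eta = g *: (qi c)^% ->
  resinf (e * dual_num p v * (f * g - ((qj c)^% *m A *m eta) 0 0)) = 0.
Proof.
move=> /dual_cond_dvd[N eN] eEta.
pose al := (v^% *m A *m (qX c)^% *m eta) 0 0.
pose be := (v^% *m A *m derivmx eta) 0 0.
pose ga := (v^% *m derivmx A *m eta) 0 0.
pose xi := ((v *m X)^% *m A *m eta) 0 0.
pose ze := ((qj c)^% *m A *m eta) 0 0.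
pose s := (v^% *m A *m eta) 0 0.
pose ai := (v^% *m A *m (qi c)^%) 0 0.
have D00 (M N' : 'M[{poly k}]_1) : (M + N') 0 0 = M 0 0 + N' 0 0 by rewrite mxE.
have B00 (M N' : 'M[{poly k}]_1) : (M - N') 0 0 = M 0 0 - N' 0 0 by rewrite
  !mxE.
have Z00 u (M : 'M[{poly k}]_1) : (u *: M) 0 0 = u * M 0 0 by rewrite mxE.
have M00 (M N' : 'M[{poly k}]_1) : (M *m N') 0 0 = M 0 0 * N' 0 0.
  by rewrite mxE big_ord1.
have h1 : ai * g = al - be.
  have := congr1 (mulmx (v^% *m A)) eEta; rewrite mulmxBr -scalemxAr mulmxA.
  by move=> /(congr1 (fun M : 'M_1 => M 0 0)); rewrite B00 Z00 mulrC => ->.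
have h2 : ai * ze = f * ga - f^`() * s + f * al - f * xi.
  rewrite -M00 !mulmxA; have := congr1 (fun M => v^% *m M *m eta) (AijA hc).
  rewrite mulmxBr mulmxBl mulmxDr mulmxDl mulmxBr mulmxBl.
  rewrite -!scalemxAr -!scalemxAl !mulmxA -map_mxM => ->.
  by rewrite B00 D00 B00 !Z00.
have h3 : s^`() = ga + be.
  have -> : s^`() = (derivmx (v^% *m A *m eta)) 0 0 by rewrite /derivmx mxE.
  by rewrite !derivmxM derivmxC mul0mx add0r D00.
have [w hw] : exists w, e * (xi - p * ze) = f * w.
  exists ((N *m eta) 0 0).
  have := congr1 (fun M : 'rV_n => (M *m eta) 0 0) eN.
  by rewrite !mulmxBl -!scalemxAl !Z00 mulmxBl -scalemxAl B00 Z00.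
(* w is the pole-free term, and u corrects for moving e inside the derivative. *)
have [u hu] := dvdpP _ _ e_deriv.
have -> : e * dual_num p v * (f * g - ze) =
   f ^+ 2 * (e * p * g + w + u * s) - (f * (e * s)^`() - f^`() * (e * s)).
  rewrite /dual_num -/ai;
    transitivity (e * (p * f ^+ 2 * g) + f * e * (ai * g) -
     f * p * (e * ze) - e * (ai * ze)); first by ring.
  rewrite h1 h2 derivM h3 hu.
  have -> : f ^+ 2 * (e * p * g + w + u * s) =
     f ^+ 2 * (e * p * g + u * s) + f * (e * (xi - p * ze)) by rewrite hw; ring.
  by ring.
by rewrite resinfB resinf_deriv resinf_dvd ?subr0 // dvdp_mulIl.
Qed.

(** By nondegeneracy f^2 divides e times [dual_num p v], and degrees force v (Y - z)^{-1} i = 0 and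
    p = 0. Then v g(Y) i = 0 for all g and v X e(Y) = 0, whence v g(Y) X e(Y) = v g'(Y). So the g
    with v g(Y) = 0 are stable under differentiation; f is among them, hence so is a nonzero
    constant. *)
Lemma dual_cond_inj p v : dual_cond p v -> (size p <= m)%N -> v *m horner_mx Y
  e = v ->
  (forall h, resinf (e * dual_num p v * h) = 0) -> p = 0 /\ v = 0.
Proof.
move=> cond sp ve /resinf_nondeg H0; pose ai := (v^% *m A *m (qi c)^%) 0 0.
have sai (w : 'rV[k]_n) : (size ((w^% *m A *m (qi c)^%) 0 0)%R <= n)%N.
  rewrite mxE; apply: leq_trans (size_sum _ _ _) _; apply/bigmax_leqP => i _.
  rewrite mxE [(_ ^%) i 0]mxE mulrC mul_polyC.
  apply: leq_trans (size_scale_leq _ _) _.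
  apply: leq_trans (size_sum _ _ _) _; apply/bigmax_leqP => j _.
  rewrite [(w^%) 0 j]mxE mul_polyC; apply: leq_trans (size_scale_leq _ _) _.
  exact: size_A.
have small g : (size g <= n)%N -> f %| g -> g = 0.
  move=> sg fg; apply/eqP/negPn/negP => g0; have := dvdp_leq g0 fg.
  by rewrite (size_f c) ltnNge sg.
have ai0 : ai = 0.
  apply: small; first exact: sai.
  have [N eN] := horner_A e.
  have E1 : e *: A = (horner_mx Y e)^% *m A + f *: N.
    by rewrite -eN addrC subrK.
  have : f %| e * ai.
    have : f %| e * dual_num p v by apply: dvdp_trans H0;
      rewrite expr2 dvdp_mulIl.
    by rewrite /dual_num mulrDr dvdp_addr // mulrA dvdp_mulIr.
  have -> : e * ai = ai + f * ((v^% *m N *m (qi c)^%) 0 0).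
    have -> : e * ai = (v^% *m (e *: A) *m (qi c)^%) 0 0.
      by rewrite -scalemxAr -scalemxAl [RHS]mxE.
    by rewrite E1 mulmxDr mulmxDl mxE mulmxA -map_mxM ve -scalemxAr -scalemxAl
      [X in _ + X]mxE.
  by rewrite dvdp_addl // dvdp_mulIl.
have p0 : p = 0.
  have tp : t ^+ m %| p.
    have : f ^+ 2 %| e * (p * f) by move: H0; rewrite /dual_num -/ai ai0 addr0.
    rewrite mulrA expr2 dvdp_mul2r ?f_neq0 // fE => /(dvdp_trans (dvdp_mulIl _
      _)).
    rewrite Gauss_dvdpr //; apply: coprimep_expl.
    rewrite coprimep_sym coprimep_XsubC; apply/negP => /rootP el.
    have : t %| e - 1.
      by apply: dvdp_trans e1;
        rewrite -{1}[t]expr1 dvdp_exp2l // muln_gt0 m_gt0.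
    by rewrite dvdp_XsubCl /root !hornerE el sub0r oppr_eq0 oner_eq0.
  apply/eqP/negPn/negP => p0; have := dvdp_leq p0 tp.
  by rewrite size_exp_XsubC ltnNge sp.
split=> //.
have vXe : v *m X *m horner_mx Y e = 0.
  by have := cond; rewrite /dual_cond p0 rmorph0 mulmx0 subr0.
(* As Y A = z A + f, the polynomial w Y A i equals f times w i; its degree is below n = deg f, so
   both vanish. *)
have step (w : 'rV[k]_n) : (w^% *m A *m (qi c)^%) 0 0 = 0 ->
    w *m qi c = 0 /\ ((w *m Y)^% *m A *m (qi c)^%) 0 0 = 0.
  move=> wAi; have YA : Y^% *m A = 'X *: A + f%:M.
    have := bA c; rewrite {1}/charX mulmxBl mul_scalar_mx => <-.
    by rewrite addrC subrK.
  have ewY : ((w *m Y)^% *m A *m (qi c)^%) 0 0 = f * ((w *m qi c) 0 0)%:P.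
    rewrite map_mxM -[_ *m _ *m A]mulmxA YA mulmxDr mulmxDl -scalemxAr
      -scalemxAl.
    rewrite mxE [X in X + _]mxE wAi mulr0 add0r mul_mx_scalar -scalemxAl mxE.
    by rewrite -map_mxM [X in _ * X]mxE.
  have wY0 : ((w *m Y)^% *m A *m (qi c)^%) 0 0 = 0.
    by apply: small; [exact: sai | rewrite ewY dvdp_mulIl].
  split=> //; apply/matrixP => i j; rewrite !ord1 [RHS]mxE; apply/eqP.
  by move/eqP: ewY; rewrite wY0 eq_sym mulf_eq0 (negPf f_neq0) polyC_eq0.
have hornerX g s : horner_mx Y (g * 'X + s%:P) = horner_mx Y g *m Y + s%:M.
  by rewrite rmorphD rmorphM /= horner_mx_X horner_mx_C.
have hornerC g : horner_mx Y g *m Y = Y *m horner_mx Y g.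
  have : horner_mx Y (g * 'X) = horner_mx Y ('X * g) by rewrite mulrC.
  by rewrite !rmorphM /= !horner_mx_X.
have vgi g (w : 'rV[k]_n) : (w^% *m A *m (qi c)^%) 0 0 = 0 ->
    w *m horner_mx Y g *m qi c = 0.
  elim/poly_ind: g w => [|g s IH] w wAi; first by rewrite rmorph0 mulmx0 mul0mx.
  have [wi wYAi] := step w wAi.
  rewrite hornerX hornerC mulmxDr mulmxDl mulmxA IH // add0r mul_mx_scalar.
  by rewrite -scalemxAl wi scaler0.
have geC g : horner_mx Y g *m horner_mx Y e = horner_mx Y e *m horner_mx Y g.
  have : horner_mx Y (g * e) = horner_mx Y (e * g) by rewrite mulrC.
  by rewrite !rmorphM.
have vgX g : v *m horner_mx Y g *m X *m horner_mx Y e = v *m horner_mx Y g^`().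
  elim/poly_ind: g => [|g s IH];
    first by rewrite deriv0 !rmorph0 mulmx0 !mul0mx.
  rewrite derivD derivC addr0 derivM derivX mulr1 hornerX.
  rewrite [horner_mx Y (_ + _)]rmorphD rmorphM /= horner_mx_X.
  rewrite mulmxDr !mulmxDl mul_mx_scalar -!scalemxAl vXe scaler0 addr0.
  have YX : Y *m X = X *m Y + 1%:M - qi c *m qj c.
    by rewrite -hc [_ - _ + 1%:M]addrAC opprB [RHS]addrC subrK.
  rewrite mulmxA -[v *m _ *m Y *m X]mulmxA YX mulmxBr mulmxDr mulmx1 mulmxBl
    mulmxDl.
  rewrite [_ *m (qi c *m qj c)]mulmxA vgi // !mul0mx subr0.
  rewrite mulmxA -[_ *m Y *m horner_mx Y e]mulmxA -hornerC mulmxA IH.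
  by rewrite -[v *m _ *m horner_mx Y e]mulmxA geC mulmxA ve mulmxDr mulmxA.
have [|r|s s0] := @poly_descent _ (fun g => v *m horner_mx Y g = 0) f hk f_neq0.
- by rewrite horner_mx_f mulmx0.
- by move=> vr; rewrite -vgX vr !mul0mx.
rewrite horner_mx_C mul_mx_scalar => /eqP.
by rewrite scaler_eq0 (negPf s0) => /eqP.
Qed.

Local Notation E := (horner_mx Y e).
Local Notation rk := (\rank E).

(** The unknowns are the m coefficients of p and the coordinates of v in the row space of E. As E is
    [col_base E] times the free [row_base E], multiplying by [col_base E] alone states the condition
    without redundant equations. *)
Definition dual_defect (u : 'rV[k]_(m + rk)) : 'rV[k]_rk :=
  (rsubmx u *m row_base E *m X - qj c *m horner_mx Y (rVpoly (lsubmx u)))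
    *m col_base E.

Fact dual_defect_is_linear : linear dual_defect.
Proof.
move=> a u w; rewrite /dual_defect [rsubmx _]linearP [lsubmx _]linearP /=.
rewrite [rVpoly _]linearP; set p1 := rVpoly _; set p2 := rVpoly _.
have -> : horner_mx Y (a *: p1 + p2) = a *: horner_mx Y p1 + horner_mx Y p2.
  by rewrite linearP.
rewrite scalemxAl -mulmxDl; congr (_ *m _).
rewrite mulmxDr !mulmxDl -!scalemxAl -scalemxAr.
by rewrite opprD addrACA -scalerBr.
Qed.
HB.instance Definition _ := GRing.isLinear.Build k 'rV[k]_(m + rk) 'rV[k]_rk
  *:%R dual_defect dual_defect_is_linear.

Definition dual_functional (u : 'rV[k]_(m + rk)) : 'rV[k]_(2 * n) :=
  lfun (e * dual_num (rVpoly (lsubmx u)) (rsubmx u *m row_base E)).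

Fact dual_functional_is_linear : linear dual_functional.
Proof.
move=> a u w; apply/rowP => r; rewrite !mxE !linearP /= mulmxDl -scalemxAl.
set p1 := rVpoly _; set p2 := rVpoly _; set v1 := _ *m _; set v2 := _ *m _.
have -> : dual_num (a *: p1 + p2) (a *: v1 + v2) = a *: dual_num p1 v1 +
  dual_num p2 v2.
  rewrite /dual_num map_mxD.
  have -> : (a *: v1)^% = a%:P *: v1^%.
    by apply/matrixP => i j; rewrite !mxE polyCM.
  rewrite !mulmxDl -!scalemxAl mxE [X in _ + (X + _)]mxE mul_polyC.
  by rewrite mulrDl -scalerAl scalerDr addrACA.
rewrite mulrDr mulrDl -!scalerAr -scalerAl resinfD resinfZ mulrDl.
by rewrite !mulrA.
Qed.
HB.instance Definition _ := GRing.isLinear.Build k 'rV[k]_(m + rk) 'rV[k]_(2 *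
  n)
  *:%R dual_functional dual_functional_is_linear.

Lemma E_idem : E *m E = E.
Proof.
have -> : E *m E = horner_mx Y (e * e) by rewrite rmorphM.
apply: horner_mx_mod; apply: dvdp_trans (_ : f ^+ 2 %| _).
  by rewrite expr2 dvdp_mulIl.
by have := e_idem; rewrite mulrBr mulr1.
Qed.

Lemma row_base_E : row_base E *m E = row_base E.
Proof.
have /submxP[Z ->] : (row_base E <= E)%MS by rewrite eq_row_base.
by rewrite -mulmxA E_idem.
Qed.

Lemma dual_defect_dual_cond u : dual_defect u = 0 ->
  dual_cond (rVpoly (lsubmx u)) (rsubmx u *m row_base E).
Proof.
move=> /(congr1 (mulmx^~ (row_base E))); rewrite /= mul0mx -mulmxA mulmx_base.
by [].
Qed.

Lemma dual_functional_inj u : dual_defect u = 0 -> dual_functional u = 0 -> u =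
  0.
Proof.
move=> Tu Su; have [||h|p0 v0] := dual_cond_inj (dual_defect_dual_cond Tu).
- exact: size_poly.
- by rewrite -mulmxA row_base_E.
- have Gt : f ^+ 2 %| e * dual_num (rVpoly (lsubmx u)) (rsubmx u *m row_base E)
      * t ^+ (2 * n) by rewrite mulrAC dvdp_mulr // e_tn.
  rewrite -functional_lfun // -/(dual_functional u) Su /functional big1 // => i
    _.
  by rewrite mxE mul0r.
rewrite -[u]hsubmxK; have -> : lsubmx u = 0.
  by rewrite -[lsubmx u]rVpolyK p0 linear0.
have -> : rsubmx u = 0.
  by apply: (row_free_inj (row_base_free E)); rewrite /= v0 mul0mx.
by rewrite row_mx0.
Qed.

(* The functional w annihilates f psi: for polynomial h, take
   eta = adj(X - d/dz) i h and g = det(X - d/dz) h. *)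
Definition kills (w : 'rV[k]_(2 * n)) (z : k) : Prop :=
  forall (eta : 'cV[{poly k}]_n) g,
    (qX c)^% *m eta - derivmx eta = g *: (qi c)^% ->
    functional w z (f * g - ((qj c)^% *m A *m eta) 0 0) = 0.

(* [dual_defect] imposes rk linear conditions on m + rk unknowns. *)
Lemma local_space : exists U : {vspace 'rV[k]_(2 * n)},
  \dim U = m /\ forall w, w \in U -> kills w l.
Proof.
pose T := lin1_mx dual_defect; pose Rk := row_base (kermx T).
have mr : (m <= \rank (kermx T))%N.
  by rewrite mxrank_ker leq_subRL ?rank_leq_row // addnC leq_add2l rank_leq_col.
(* Exactly m independent solutions are kept, since the dimension of the space is the exponent of z -
   l in q. *)
pose Mk : 'M[k]_(m, m + rk) := (pid_mx m : 'M_(m, \rank (kermx T))) *m Rk.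
have fM : row_free Mk.
  by rewrite /row_free mxrankMfree ?row_base_free // rank_pid_mx.
have MT (a : 'rV_m) : dual_defect (a *m Mk) = 0.
  have RT : Rk *m T = 0 by apply/sub_kermxP; rewrite eq_row_base.
  transitivity (a *m Mk *m T); first by rewrite /T mul_rV_lin1.
  by rewrite /Mk -mulmxA -mulmxA RT !mulmx0.
pose B : m.-tuple 'rV[k]_(2 * n) := [tuple dual_functional (row a Mk) | a < m].
have BE (a : 'I_m -> k) : \sum_i a i *: B`_i = dual_functional ((\row_i a i) *m
  Mk).
  rewrite mulmx_sum_row linear_sum; apply: eq_bigr => i _.
  rewrite linearZ /= [(\row_i a i) 0 i]mxE; congr (_ *: _).
  by rewrite -[RHS](tnth_mktuple (fun a => dual_functional (row a Mk)))
    (tnth_nth 0).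
have fB : free B.
  apply/freeP => a; rewrite BE => /(dual_functional_inj (MT _)) aM i.
  have /rowP/(_ i) : \row_i a i = 0.
    by apply: (row_free_inj fM); rewrite /= aM mul0mx.
  by rewrite !mxE.
exists <<B>>%VS; split; first by move: fB; rewrite /free size_tuple => /eqP.
move=> w /coord_span ->; rewrite BE; set u := _ *m Mk => eta g eEta.
have Gt : f ^+ 2 %| e * dual_num (rVpoly (lsubmx u)) (rsubmx u *m row_base E)
    * t ^+ (2 * n) by rewrite mulrAC dvdp_mulr // e_tn.
by rewrite functional_lfun // (resinf_dual_num (dual_defect_dual_cond (MT _))
  eEta).
Qed.
End LocalFunctionals.

(** * Adelic data for a given quadruple *)

Section Existence.
Variables (k : closedFieldType) (n' : nat).
Hypothesis hk : [pchar k] =i pred0.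
Local Notation n := n'.+1.
Variable c : quad k n.
Hypothesis hc : cm_eq c.
Local Notation "M ^%" := (map_mx polyC M) (at level 2).
Local Notation f := (\det (charX (qY c))).
Local Notation A := (\adj (charX (qY c))).

Lemma local_space_count (rs : seq k) l :
  f = lead_coef f *: \prod_(z <- rs) ('X - z%:P) ->
  exists U : {vspace 'rV[k]_(2 * n)},
    \dim U = count_mem l rs /\ forall w, w \in U -> kills c w l.
Proof.
move=> ef; have lf0 : lead_coef f != 0 by rewrite lead_coef_eq0 det_charX_neq0.
have [m0|m_gt0] := posnP (count_mem l rs).
  exists 0%VS; rewrite dimv0 m0; split=> // w /[!memv0] /eqP -> eta g _.
  by rewrite /functional big1 // => i _; rewrite mxE mul0r.
pose f0 := lead_coef f *: \prod_(z <- rs | z != l) ('X - z%:P).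
have fE : f = ('X - l%:P) ^+ count_mem l rs * f0.
  rewrite {1}ef (bigID (fun z => z == l)) /= -scalerAr; congr (_ *: (_ * _)).
  rewrite (eq_bigr (fun=> 'X - l%:P)) => [|z /eqP -> //].
  by rewrite big_const_seq iter_mulr_1.
have f0l : f0.[l] != 0.
  rewrite hornerZ mulf_neq0 // horner_prod prodf_seq_neq0; apply/allP => z _.
  by apply/implyP => zl; rewrite hornerXsubC subr_eq0 eq_sym.
(* The idempotent of the Chinese remainder theorem: e = v f0^2 is 1 modulo (z - l)^{2m} and 0 modulo
   f0^2. *)
have /Bezout_eq1_coprimepP[[u v] /= uv] :
    coprimep (('X - l%:P) ^+ (2 * count_mem l rs)) (f0 ^+ 2).
  by apply/coprimep_expl/coprimep_expr; rewrite coprimep_sym coprimep_XsubC.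
apply: (@local_space _ _ hk c hc l _ f0 (v * f0 ^+ 2)) => //.
- by rewrite -uv opprD addrCA subrr addr0 dvdpNr dvdp_mull.
- exact: dvdp_mull.
Qed.

(** It suffices to test on polynomials h. There f kappa d yields f g - j A eta with g = det(X -
    d/dz) h, and Cramer's rule for X - d/dz is the equation linking eta and g. *)
Lemma kills_baker (C : adelic_data k) l (w : 'rV[k]_(2 * n)) :
  kills c w l -> exp_functional w l (symbol (kappa_num c)) = 0.
Proof.
move=> kw; apply/(functional_opP hk) => h.
pose eta : 'cV[{poly k}]_n :=
  \col_r dop ((\adj (charX (qX c)) *m (qi c)^%) r 0) h.
rewrite -(kw eta (dop (\det (charX (qX c))) h)).
  congr functional; rewrite /kappa_num.
  have opB P1 P2 : op (P1 - P2) h = op P1 h - op P2 h.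
    by apply/eqP; rewrite eq_sym subr_eq -opD subrK.
  rewrite opB op_mull opC op_sum [in RHS]mxE; congr (_ - _).
  by apply: eq_bigr => r _; rewrite op_mull opC [eta r 0]mxE.
pose z := \adj (charX (qX c)) *m (qi c)^%.
have zE : (qX c)^% *m z - 'X *: z = \det (charX (qX c)) *: (qi c)^%.
  have := congr1 (mulmx^~ (qi c)^%) (mul_mx_adj (charX (qX c))).
  by rewrite /= -mulmxA -/z mul_scalar_mx {1}/charX mulmxBl mul_scalar_mx.
apply/colP => r; have /(congr1 (fun M : 'cV_n => dop (M r 0) h)) := zE.
rewrite ![in X in X -> _]mxE => zr.
have dopB (p1 p2 : {poly k}) : dop (p1 - p2) h = dop p1 h - dop p2 h.
  by apply/eqP; rewrite eq_sym subr_eq -dopD subrK.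
move: zr; rewrite dopB dop_sum dopXM -dop_deriv mulrC mul_polyC dopZ => zr.
rewrite [RHS]mxE [(qi c)^% r 0]mxE mulrC mul_polyC -zr.
rewrite [LHS]mxE [X in X + _]mxE; congr (_ + _); last first.
  by rewrite !mxE.
by apply: eq_bigr => s _; rewrite ![(_^%) r s]mxE !mul_polyC dopZ [eta s 0]mxE.
Qed.

(** The entries of adj(Y - z) have degree below n = deg f; this is what normalises psi at
    infinity. *)
Lemma size_kappa_num :
  (size (kappa_num c - map_poly polyC f * (\det (charX (qX c)))%:P)%R <= n)%N.
Proof.
rewrite /kappa_num addrAC subrr add0r size_polyN.
apply: leq_trans (size_sum _ _ _) _; apply/bigmax_leqP => r _.
apply: leq_trans (size_polyMleq _ _) _.
apply: (@leq_trans (size ((map_mx polyC (qj c) *m A) 0%R r))).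
  rewrite size_map_polyC; set s := size _.
  by case: (size _%:P) (size_polyC_leq1 ((\adj (charX (qX c)) *m (qi c)^%) r 0))
    => [|[|//]] _; rewrite ?addn0 ?addn1 // leq_pred.
rewrite mxE; apply: leq_trans (size_sum _ _ _) _; apply/bigmax_leqP => i _.
rewrite mxE mul_polyC; apply: leq_trans (size_scale_leq _ _) _.
exact: size_A.
Qed.
End Existence.

Lemma tends_to_one1 (K : fieldType) : tends_to_one (1 : ratfun K).
Proof.
rewrite (@tends_to_oneE K 1 1 1) ?oner_neq0 //; last exact: mulr1.
by rewrite subrr size_poly0 size_poly1.
Qed.

Theorem baker_exists (k : closedFieldType) (hk : [pchar k] =i pred0) (n : nat)
    (c : quad k n) (hc : cm_eq c) : exists C, is_baker C (psi_quad c).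
Proof.
case: n c hc => [|n'] c hc.
  (* For n = 0 the empty data, with W = k[z], have Baker function e^{xz}. *)
  have -> : psi_quad c = 1.
    by rewrite /psi_quad mxE big_ord0 subr0.
  exists (@AdelicData k 0 [::] isT (fun=> 0%VS)); split.
    exact: tends_to_one1.
  by eexists; split; first exact: mulr1.
set f := \det (charX (qY c)); set d := \det (charX (qX c)).
have f0 : f != 0 := det_charX_neq0 _.
have d0 : d != 0 := det_charX_neq0 _.
have [rs ef] := closed_field_poly_normal f.
have /choice[U hU] : forall l, exists U : {vspace 'rV[k]_(2 * n'.+1)},
    \dim U = count_mem l rs /\ forall w, w \in U -> kills c w l.
  by move=> l; exact: local_space_count.
pose C := @AdelicData k (2 * n'.+1) (undup rs) (undup_uniq rs) U.
have qE : ad_q C = \prod_(z <- rs) ('X - z%:P).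
  rewrite /ad_q /= -[RHS]prodr_undup_exp_count; apply: eq_bigr => l _.
  by have [-> _] := hU l.
(* The local dimensions are the multiplicities of the roots, so f is its leading coefficient times
   q, and dividing the symbol of [kappa_num] by a leaves q psi. *)
pose a : ratfun k := ratC (lead_coef f) * tofrac d.
have a0 : a != 0.
  by rewrite mulf_neq0 ?tofrac_eq0 // fmorph_eq0 lead_coef_eq0.
pose g := a^-1 *: symbol (kappa_num c).
have eg : tofrac (map_poly (@ratC k) (ad_q C)) * psi_quad c = tofrac g.
  have Da0 : tofrac a%:P != 0 :> ratfun2 k by rewrite tofrac_eq0 polyC_eq0.
  apply: (mulIf Da0); rewrite -[RHS]tofracM /g -scalerAl [_ * a%:P]mulrC.
  rewrite mul_polyC scalerA mulVf // scale1r -psi_clear -/f -/d ef -qE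
    map_polyZ /=.
  rewrite -mul_polyC /a polyCM !tofracM.
  have mulE (L : comNzRingType) (u1 u2 u3 u4 : L) :
    u1 * u2 * (u3 * u4) = u3 * u1 * u2 * u4 by ring.
  exact: mulE.
exists C; split; last first.
  exists g; split=> // l lC w wC.
  rewrite -[g]addr0 exp_functionalP exp_functional0 addr0.
  by rewrite kills_baker ?mulr0 //; have [_ h] := hU l; exact: h.
rewrite (tends_to_oneE _ eg); last first.
  by rewrite map_poly_eq0 qE monic_neq0 // monic_prod_XsubC.
have -> : size (map_poly (@ratC k) (ad_q C)) = n'.+2.
  rewrite size_map_poly qE -(size_f c) -/f ef size_scale ?lead_coef_eq0 //.
rewrite ltnS; have -> : g - map_poly (@ratC k) (ad_q C) =
    a^-1 *: symbol (kappa_num c - map_poly polyC f * d%:P).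
  have -> : symbol (kappa_num c - map_poly polyC f * d%:P) =
      symbol (kappa_num c) - map_poly (@ratC k) f * (tofrac d)%:P.
    rewrite -symbol_ratC /symbol rmorphB rmorphM /=; congr (_ - _ * _).
    by rewrite map_polyC.
  rewrite scalerBr /g; congr (_ - _).
  have -> : map_poly (@ratC k) f = ratC (lead_coef f) *: map_poly (@ratC k)
    (ad_q C).
    by rewrite {1}ef -qE map_polyZ.
  rewrite [_ * _%:P]mulrC mul_polyC !scalerA -mulrA [tofrac d * _]mulrC.
  by rewrite -/a mulVf // scale1r.
apply: leq_trans (size_scale_leq _ _) _.
by rewrite size_sym; exact: size_kappa_num.
Qed.

(** * Independence of the representative of the orbit *)

Lemma invmx_conj (k : fieldType) (L : fieldType) (emb : {rmorphism k -> L}) n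
    (g M : 'M[k]_n) (z : L) :
  g \in unitmx -> map_mx emb M - z%:M \in unitmx ->
  invmx (map_mx emb (g *m M *m invmx g) - z%:M) =
  map_mx emb g *m invmx (map_mx emb M - z%:M) *m map_mx emb (invmx g).
Proof.
move=> gU MU; set G := map_mx emb g; set G' := map_mx emb (invmx g).
have GG' : G *m G' = 1%:M by rewrite -map_mxM mulmxV // map_mx1.
have G'G : G' *m G = 1%:M by rewrite -map_mxM mulVmx // map_mx1.
have -> : map_mx emb (g *m M *m invmx g) - z%:M =
    G *m (map_mx emb M - z%:M) *m G'.
  rewrite !map_mxM mulmxBr mulmxBl mul_mx_scalar -scalemxAl GG'.
  by rewrite scalemx1.
set B := map_mx emb M - z%:M in MU *.
have BU : G *m B *m G' *m (G *m invmx B *m G') = 1%:M.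
  rewrite -!mulmxA [G' *m (G *m _)]mulmxA G'G mul1mx [B *m (_ *m _)]mulmxA.
  by rewrite mulmxV // mul1mx GG'.
have [U _] := mulmx1_unit BU.
by rewrite -[LHS]mulmx1 -BU mulKmx.
Qed.

Lemma kappa_gl_act (k : fieldType) (L : fieldType) (emb : {rmorphism k -> L}) n
    (g : 'M[k]_n) (c : quad k n) (z x : L) :
  g \in unitmx -> map_mx emb (qY c) - z%:M \in unitmx ->
  map_mx emb (qX c) - x%:M \in unitmx ->
  map_mx emb (qj (gl_act g c)) *m invmx (map_mx emb (qY (gl_act g c)) - z%:M)
    *m invmx (map_mx emb (qX (gl_act g c)) - x%:M)
    *m map_mx emb (qi (gl_act g c)) =
  map_mx emb (qj c) *m invmx (map_mx emb (qY c) - z%:M)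
    *m invmx (map_mx emb (qX c) - x%:M) *m map_mx emb (qi c).
Proof.
move=> gU YU XU; rewrite /= !invmx_conj // !map_mxM.
have GG : map_mx emb (invmx g) *m map_mx emb g = 1%:M.
  by rewrite -map_mxM mulVmx // map_mx1.
rewrite !mulmxA.
do 3!rewrite -[_ *m map_mx emb (invmx g) *m map_mx emb g]mulmxA GG mulmx1.
by [].
Qed.

Lemma psi_quad_gl_act (k : closedFieldType) n (g : 'M[k]_n) (c : quad k n) :
  g \in unitmx -> psi_quad (gl_act g c) = psi_quad c.
Proof.
move=> gU.
pose phz : {rmorphism {poly k} -> ratfun2 k} :=
  (@tofrac {poly ratfun k}) \o (map_poly (@ratC k)).
pose phx : {rmorphism {poly k} -> ratfun2 k} :=
  (@tofrac {poly ratfun k}) \o (@polyC (ratfun k)) \o (@tofrac {poly k}).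
pose emb : {rmorphism k -> ratfun2 k} :=
  (@tofrac {poly ratfun k}) \o (@polyC (ratfun k)) \o (@ratC k).
have psiE (c' : quad k n) : psi_quad c' = 1 - (map_mx emb (qj c')
   *m invmx (map_mx emb (qY c') - (phz 'X)%:M)
   *m invmx (map_mx emb (qX c') - (phx 'X)%:M) *m map_mx emb (qi c')) 0 0.
  by rewrite /psi_quad /phz /= map_polyX.
have phzC t : phz t%:P = emb t by rewrite /phz /= map_polyC.
have phxC t : phx t%:P = emb t by [].
have YU : map_mx emb (qY c) - (phz 'X)%:M \in unitmx.
  rewrite (map_charX_field phzC) unitmxE det_map_mx unitfE.
  by rewrite tofrac_eq0 map_poly_eq0 det_charX_neq0.
have XU : map_mx emb (qX c) - (phx 'X)%:M \in unitmx.
  rewrite (map_charX_field phxC) unitmxE det_map_mx unitfE.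
  by rewrite tofrac_eq0 polyC_eq0 tofrac_eq0 det_charX_neq0.
rewrite (psiE (gl_act g c)) (psiE c).
exact: (congr1 (fun M : 'M_1 => 1 - M 0 0) (kappa_gl_act gU YU XU)).
Qed.

Lemma cm_eq_gl_act (k : fieldType) n (g : 'M[k]_n) (c : quad k n) :
  g \in unitmx -> cm_eq c -> cm_eq (gl_act g c).
Proof.
rewrite /cm_eq /= => gU hc.
have gM (M N : 'M[k]_n) : g *m M *m invmx g *m (g *m N *m invmx g) =
    g *m (M *m N) *m invmx g.
  by rewrite !mulmxA mulmxKV.
have -> : g *m qi c *m (qj c *m invmx g) = g *m (qi c *m qj c) *m invmx g.
  by rewrite !mulmxA.
rewrite !gM -hc.
by rewrite mulmxDr mulmxBr mulmxDl mulmxBl mulmx1 mulmxV.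
Qed.

Theorem corollary3 (k : closedFieldType) (hk : [pchar k]%R =i pred0)
    (A : algType k) (x y : A) (hA : weyl_algebra x y)
    (Q : unitAlgType k) (iota : {lrmorphism A -> Q})
    (hQ : quotient_skew_field iota)
    (rho : A -> ratfun k -> ratfun k) (hrho : weyl_rep x y rho)
    (n : nat) (P : set (quad k n)) (hP : calogero_moser P)
    (c : quad k n) (hc : P c) :
  right_iso iota rho (M_x x y iota c) (omega P) /\
  right_iso iota rho (M_y x y iota c) (omega P).
Proof.
have [c0 hc0 eP] := hP; rewrite -eP in hc.
have [g gU ec] := hc.
have cmc : cm_eq c by rewrite -ec; exact: cm_eq_gl_act.
have [C0 hC0] := baker_exists hk cmc.
(* The data of the chosen W come with some representative c' of P; invariance of psi under the group
   turns its Baker function into that of c. *)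
have [C [eW [c' Pc' hC]]] : exists C, wilson P = ad_W C /\
    exists2 c', P c' & is_baker C (psi_quad c').
  apply: (@xgetPex _ _ [set W | exists C : adelic_data k, W = ad_W C /\
    exists2 c, P c & is_baker C (psi_quad c)]%classic).
  by exists (ad_W C0), C0; split=> //; exists c => //; rewrite -eP.
have [g' g'U ec'] : gl_orbit c0 c' by rewrite eP.
rewrite -ec' psi_quad_gl_act // -(psi_quad_gl_act c0 gU) ec in hC.
rewrite /omega eW; split.
  exact: (ideal_iso_x hk hA hQ hrho cmc hC).
exact: (ideal_iso_y hk hA hQ hrho cmc hC).
Qed.
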